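(* For a self-adjoint operator $X$ on $\mathbf{H}$ put $Z(X)=\int_{\mathbf{P}} e^{\operatorname{Tr}(XP)}\,d\sigma(P)$ and $W(X)=\ln Z(X)$, and let $$\chi(X)=\nabla W(X)=\frac{1}{Z(X)}\int_{\mathbf{P}} e^{\operatorname{Tr}(XP)}\,P\,d\sigma(P).$$ Then the restriction of $\chi$ to $\mathcal{N}$ is a diffeomorphism $$\chi:\mathcal{N}\to\mathcal{D}$$ between the set $\mathcal{N}$ of all traceless self-adjoint operators in $\mathbf{H}$ and the interior $\mathcal{D}$ of the set of all separable density operators in $\mathbf{H}$.
   Context: Let $\mathbf{H}=H^{(1)}\otimes\cdots\otimes H^{(N)}$ be a tensor product of finitely many nonzero finite-dimensional complex Hilbert spaces. $\mathbf{P}$ denotes the compact set of all pure product states, i.e. operators $P=P^{(1)}\otimes\cdots\otimes P^{(N)}$ where each $P^{(I)}$ is a one-dimensional orthogonal projector in $H^{(I)}$. $\sigma$ is the probability measure on $\mathbf{P}$ invariant under all local unitary transformations $P\mapsto (U_1\otimes\cdots\otimes U_N)P(U_1\otimes\cdots\otimes U_N)^*$, $U_I$ unitary on $H^{(I)}$ (it is unique since the action is transitive). A density operator is a positive semidefinite operator on $\mathbf{H}$ of trace $1$; it is separable if it belongs to the convex hull of $\mathbf{P}$. The gradient $\nabla$ is taken on the real vector space of self-adjoint operators on $\mathbf{H}$ with respect to the inner product $\operatorname{Tr}(XY)$. The interior $\mathcal{D}$ is taken in the affine space of self-adjoint operators of trace $1$, of which $\mathcal{D}$ is an open subset; this gives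 the manifold structure on $\mathcal{D}$. *)

(* Defs.v *)
From HB Require Import structures.
From mathcomp Require Import all_boot all_order all_algebra.
From mathcomp Require Import sesquilinear spectral.
From mathcomp Require Import all_classical all_reals all_analysis.
From mathcomp Require Import complex ring lra.

Set Implicit Arguments.
Unset Strict Implicit.
Unset Printing Implicit Defensive.

Import Order.TTheory GRing.Theory Num.Theory.
Import numFieldNormedType.Exports.

Local Open Scope classical_set_scope.
Local Open Scope ring_scope.
Local Open Scope complex_scope.
Local Open Scope sesquilinear_scope.

Section HermitianOperators.
Context {R : realType} {n : nat}.

(* Multiplication by i does not preserve self-adjointness, and the matrices over
   R[i] only carry a complex module structure: the self-adjoint operators on
   C^n are therefore packaged as a type, with their structure of real inner
   product space for <X, Y> = Tr(XY). *)
Definition selfadjoint : pred 'M[R[i]]_n := [pred A | A \is hermsymmx].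

Record herm := Herm {
  hmx :> 'M[R[i]]_n;
  hmxP : selfadjoint hmx }.

HB.instance Definition _ := [isSub for hmx].
HB.instance Definition _ := [Choice of herm by <:].

Lemma selfadjointE (A : 'M[R[i]]_n) : selfadjoint A = (A == A^t*).
Proof. by rewrite /selfadjoint /= is_hermitianmxE expr0 scale1r. Qed.

Lemma herm_entry (X : herm) i j : hmx X i j = conjc (hmx X j i).
Proof.
by have := hmxP X; rewrite selfadjointE => /eqP {1}->; rewrite !mxE.
Qed.

Lemma selfadjoint_zmod : zmod_closed selfadjoint.
Proof.
split=> [|A B]; rewrite -!topredE /= !selfadjointE.
  by rewrite linear0 map_mx0.
by move=> /eqP hA /eqP hB; rewrite linearB/= map_mxB -hA -hB.
Qed.
HB.instance Definition _ :=
  GRing.isZmodClosed.Build 'M[R[i]]_n selfadjoint selfadjoint_zmod.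
HB.instance Definition _ := [SubChoice_isSubZmodule of herm by <:].

Lemma hscale_subproof (a : R) (X : herm) : selfadjoint (a%:C *: hmx X).
Proof.
rewrite selfadjointE; apply/eqP/matrixP => i j.
by rewrite !mxE herm_entry rmorphM /= -[Num.conj a%:C]/(conjc a%:C) conjc_real.
Qed.
Definition hscale (a : R) (X : herm) : herm := Herm (hscale_subproof a X).

Lemma hmxD (X Y : herm) : hmx (X + Y) = hmx X + hmx Y.
Proof. by []. Qed.

Fact hscaleA a b X : hscale a (hscale b X) = hscale (a * b) X.
Proof. by apply: val_inj; rewrite /= scalerA rmorphM. Qed.
Fact hscale1 : left_id 1 hscale.
Proof. by move=> X; apply: val_inj; rewrite /= rmorph1 scale1r. Qed.
Fact hscaleDr : right_distributive hscale +%R.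
Proof. by move=> a X Y; apply: val_inj; exact: scalerDr. Qed.
Fact hscaleDl X : {morph hscale^~ X : a b / a + b}.
Proof. by move=> a b; apply: val_inj; rewrite /= rmorphD scalerDl. Qed.
HB.instance Definition _ := GRing.Zmodule_isLmodule.Build R herm
  hscaleA hscale1 hscaleDr hscaleDl.

Lemma hmxZ (a : R) (X : herm) : hmx (a *: X) = a%:C *: hmx X.
Proof. by []. Qed.

(* Tr(XY) is real for self-adjoint X and Y, see [hip_trace]. *)
Definition hip (X Y : herm) : R := complex.Re (\tr (hmx X *m hmx Y)).

Lemma hip_trace (X Y : herm) : (hip X Y)%:C = \tr (hmx X *m hmx Y).
Proof.
apply/eqP; rewrite eq_complex /hip eqxx /=; apply/eqP.
suff : \tr (hmx X *m hmx Y) = conjc (\tr (hmx X *m hmx Y)).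
  by case: (\tr _) => a b /eqP; rewrite eq_complex /= => /andP[_ /eqP h]; lra.
rewrite [in RHS]mxtrace_mulC /mxtrace rmorph_sum /=; apply: eq_bigr => i _.
rewrite !mxE rmorph_sum /=; apply: eq_bigr => j _.
by rewrite rmorphM /= -!herm_entry mulrC.
Qed.

Lemma hipC X Y : hip X Y = hip Y X.
Proof. by rewrite /hip mxtrace_mulC. Qed.

Lemma hipDl X Y Z : hip (X + Y) Z = hip X Z + hip Y Z.
Proof. by apply: complexI; rewrite rmorphD /= !hip_trace -linearD -mulmxDl. Qed.

Lemma hipZl a X Y : hip (a *: X) Y = a * hip X Y.
Proof. by apply: complexI; rewrite rmorphM /= !hip_trace -linearZ /= scalemxAl. Qed.

Lemma hipxx X : (hip X X)%:C = \sum_i \sum_j hmx X i j * conjc (hmx X i j).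
Proof.
rewrite hip_trace /mxtrace; apply: eq_bigr => i _; rewrite !mxE.
by apply: eq_bigr => j _; rewrite [hmx X j i]herm_entry.
Qed.

Lemma hip_ge0 X : 0 <= hip X X.
Proof.
rewrite -lecR hipxx; apply: sumr_ge0 => i _; apply: sumr_ge0 => j _.
exact: mulcJ_ge0.
Qed.

Lemma hip_eq0 X : hip X X = 0 -> X = 0.
Proof.
move=> X0; apply/val_inj/matrixP => i j; rewrite [RHS]mxE.
have /eqP := hipxx X; rewrite X0 eq_sym psumr_eq0; last first.
  by move=> k _; apply: sumr_ge0 => l _; exact: mulcJ_ge0.
move/allP/(_ i); rewrite mem_index_enum => /(_ isT) /=.
rewrite psumr_eq0; last by move=> l _; exact: mulcJ_ge0.
move/allP/(_ j); rewrite mem_index_enum => /(_ isT) /=.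
by rewrite mulf_eq0 => /orP[/eqP//|]; rewrite conjc_eq0 => /eqP.
Qed.

Definition hnorm (X : herm) : R := Num.sqrt (hip X X).

Lemma hip_CauchySchwarz X Y : hip X Y ^+ 2 <= hip X X * hip Y Y.
Proof.
have [Y0|Yneq0] := eqVneq (hip Y Y) 0.
  rewrite (hip_eq0 Y0) hipC -[0 : herm](scale0r X) !hipZl !mul0r.
  by rewrite expr0n mulr0.
have Ypos : 0 < hip Y Y by rewrite lt_def Yneq0 hip_ge0.
have := hip_ge0 (hip Y Y *: X + - hip X Y *: Y).
rewrite !(hipDl, hipZl) ![hip _ (_ + _)]hipC !(hipDl, hipZl) (hipC Y X).
set a := hip X X; set b := hip X Y; set c := hip Y Y => h.
have : 0 <= c * (a * c - b ^+ 2).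
  by apply: le_trans h _; rewrite le_eqVlt; apply/orP; left; apply/eqP; ring.
by rewrite pmulr_rge0 // subr_ge0.
Qed.

Fact hnormD X Y : hnorm (X + Y) <= hnorm X + hnorm Y.
Proof.
rewrite -(@ler_pXn2r _ 2) ?nnegrE ?addr_ge0 ?sqrtr_ge0 //.
rewrite sqrrD !sqr_sqrtr ?hip_ge0 //.
rewrite hipDl ![hip _ (X + Y)]hipC !hipDl (hipC Y X).
have : hip X Y <= hnorm X * hnorm Y.
  rewrite -sqrtrM ?hip_ge0 // (le_trans (ler_norm _)) // -sqrtr_sqr.
  by rewrite ler_sqrt ?hip_CauchySchwarz // mulr_ge0 ?hip_ge0.
by rewrite /hnorm; lra.
Qed.

Fact hnormZ (a : R) X : hnorm (a *: X) = `|a| * hnorm X.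
Proof.
rewrite /hnorm hipZl hipC hipZl mulrA -expr2 sqrtrM ?sqr_ge0 //.
by rewrite sqrtr_sqr.
Qed.

Fact hnorm_eq0 X : hnorm X = 0 -> X = 0.
Proof.
move=> /eqP; rewrite sqrtr_eq0 => h; apply: hip_eq0; apply/eqP.
by rewrite eq_le h hip_ge0.
Qed.

HB.instance Definition _ :=
  Lmodule_isNormed.Build R herm hnormD hnormZ hnorm_eq0.

Lemma conj_herm_subproof (U : 'M[R[i]]_n) (X : herm) :
  selfadjoint (U *m hmx X *m U^t*).
Proof.
have /eqP hX : hmx X == (hmx X)^t* by rewrite -selfadjointE hmxP.
rewrite selfadjointE !trmx_mul !map_mxM /=.
by rewrite trmxCK -hX mulmxA.
Qed.

Definition conj_herm (U : 'M[R[i]]_n) (X : herm) : herm :=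
  Herm (conj_herm_subproof U X).

End HermitianOperators.
Arguments herm : clear implicits.

Definition traceless {R : realType} (n : nat) : set (herm R n) :=
  [set X | \tr (hmx X) = 0].
Arguments traceless R n : clear implicits.

Definition trace_one {R : realType} (n : nat) : set (herm R n) :=
  [set X | \tr (hmx X) = 1].
Arguments trace_one R n : clear implicits.

(* The order of R[i] is the one for which 0 <= z means that z is a nonnegative
   real number. *)
Definition psd {R : realType} {n : nat} (X : herm R n) : Prop :=
  forall v : 'cV[R[i]]_n, 0 <= (v^t* *m hmx X *m v) 0 0.

Definition density {R : realType} {n : nat} (X : herm R n) : Prop :=
  psd X /\ \tr (hmx X) = 1.

Definition rank_one_projector {R : realType} {n : nat} (p : 'M[R[i]]_n) : Prop :=
  [/\ p \is hermsymmx, p *m p = p & \rank p = 1%N].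

(* The operators on the tensor product of the C^(d I) are the matrices in the
   orthonormal basis e_k = \otimes_I e_(k I), which is indexed by the
   multi-indices k : forall I, 'I_(d I), enumerated by [enum_val]. *)
Notation multi_index d := {dffun forall I, 'I_(d I)}.
Definition tensor_dim {N : nat} (d : 'I_N -> nat) : nat := #|{: multi_index d}|.

Definition tensor_mx {R : realType} {N : nat} {d : 'I_N -> nat}
    (A : forall I, 'M[R[i]]_(d I)) : 'M[R[i]]_(tensor_dim d) :=
  \matrix_(k, l) \prod_(I < N) A I ((enum_val k : multi_index d) I)
                                    ((enum_val l : multi_index d) I).

Section ProductStates.
Context (R : realType) {N : nat} (d : 'I_N -> nat).
Local Notation H := (herm R (tensor_dim d)).

Definition product_states : set H :=
  [set P | exists p : forall I, 'M[R[i]]_(d I),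
    (forall I, rank_one_projector (p I)) /\ hmx P = tensor_mx p].

Definition convex_hull (A : set H) : set H := smallest (@convex_set R H) A.

Definition separable : set H :=
  [set rho | density rho /\ convex_hull product_states rho].

(* The interior is taken in the subspace topology of the affine hyperplane of
   trace one operators, which contains [separable]. *)
Definition separable_interior : set H :=
  interior (separable : set (subspace (trace_one R (tensor_dim d)))).

End ProductStates.
Arguments product_states R {N} d.
Arguments separable R {N} d.
Arguments separable_interior R {N} d.

Notation borel_herm R n := (g_sigma_algebraType (@open (herm R n))).

Section PartitionFunction.
Context {R : realType} {N : nat} {d : 'I_N -> nat}.
Local Notation n := (tensor_dim d).
Local Notation P := (product_states R d).
Variable sigma : probability (borel_herm R n) R.

Definition locally_invariant : Prop :=
  forall U : (forall I, 'M[R[i]]_(d I)), (forall I, U I \is unitarymx) ->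
  forall A : set (borel_herm R n), measurable A ->
    sigma (conj_herm (tensor_mx U) @^-1` A) = sigma A.

Definition Z (X : herm R n) : R := \int[sigma]_(p in P) expR (hip X p).

Definition W (X : herm R n) : R := ln (Z X).

Definition mx_integral (F : herm R n -> 'M[R[i]]_n) : 'M[R[i]]_n :=
  \matrix_(k, l) ((\int[sigma]_(p in P) complex.Re (F p k l)) +i*
                  (\int[sigma]_(p in P) complex.Im (F p k l))).

End PartitionFunction.

(* The vector representing the differential of f at X by the inner product;
   only meaningful when f is differentiable at X. *)
Definition gradient {R : realType} {n : nat} (f : herm R n -> R) (X : herm R n) :
    herm R n :=
  get [set G | forall Y, 'd f X Y = hip G Y].

Definition chi {R : realType} {N : nat} {d : 'I_N -> nat}
    (sigma : probability (borel_herm R (tensor_dim d)) R) :=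
  gradient (W sigma).

Section Diffeomorphism.
Context {R : realType} {V V' : normedModType R}.

(* f is C^k on U, a relatively open subset of an affine subspace whose
   direction is the linear subspace L: its iterated directional derivatives
   along L, up to order k, exist and are continuous on U. The values of f off
   U are irrelevant. *)
Fixpoint Ck_on (k : nat) (L U : set V) (f : V -> V') : Prop :=
  {within U, continuous f} /\
  if k is k'.+1 then
    forall v, L v ->
      (forall x, U x -> derivable f x v) /\ Ck_on k' L U (fun x => 'D_v f x)
  else True.

Definition smooth_on (L U : set V) (f : V -> V') : Prop :=
  forall k, Ck_on k L U f.

End Diffeomorphism.

Definition diffeomorphism {R : realType} {V V' : normedModType R}
    (L U : set V) (L' U' : set V') (f : V -> V') : Prop :=
  exists g : V' -> V,
    [/\ forall x, U x -> U' (f x) /\ g (f x) = x,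
        forall y, U' y -> U (g y) /\ f (g y) = y,
        smooth_on L U f & smooth_on L' U' g].

(* Main.v *)
(* Write W = ln Z for the log-partition function of the exponential family of sigma
   on the set P of product states. Its gradient chi(X) is the mean of the probability
   measure proportional to e^Tr(Xp) dsigma(p), and its Hessian is the covariance form
   of that measure. Local invariance and transitivity of the local unitaries on the
   compact set P give sigma full support in P, and P spans the self-adjoint operators,
   so that the Hessian at X only degenerates along multiples of the identity: W is
   strictly convex on the traceless operators N and chi is injective there.
   - For y close to chi(X), the function W - Tr(. y) exceeds on a small sphere of N
     about X its value at X; an interior minimum over the ball then solves chi = y.
     Hence chi(N) is relatively open, and the inverse is continuous.
   - chi(X) is in the closure of the convex hull of P (almost nearest points). As
     chi(N) is open and the hull has interior points, chi(N) lies in the interior D.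
   - For rho in D no nonzero Y in N has Tr(Y(p - rho)) <= 0 on all of P, so that
     Z(X) e^(-Tr(X rho)) grows at least linearly in |X| on N, and a minimum of
     W - Tr(. rho) over N is a preimage of rho.
   - The differential of chi + Tr(.)1 is given by an invertible matrix whose entries
     are rational in integrals of the type of Z; Cramer's rule gives the derivatives
     of the inverse in terms of the inverse itself. *)

Require Import Defs.
From HB Require Import structures.
From mathcomp Require Import all_boot all_order all_algebra.
From mathcomp Require Import sesquilinear spectral finmap.
From mathcomp Require Import all_classical all_reals all_analysis.
From mathcomp Require Import measurable_realfun complex ring lra.

Set Implicit Arguments.
Unset Strict Implicit.
Unset Printing Implicit Defensive.

Import Order.TTheory GRing.Theory Num.Theory.
Import numFieldNormedType.Exports.

Local Open Scope classical_set_scope.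
Local Open Scope ring_scope.
Local Open Scope complex_scope.
Local Open Scope sesquilinear_scope.

(** * Coordinates and compactness *)

Section EpsilonDelta.
Context {R : realType} {V V' : normedModType R}.

Lemma continuous_atP (f : V -> V') x :
  {for x, continuous f} <->
  forall e, 0 < e -> exists2 r, 0 < r & forall y, `|x - y| < r -> `|f x - f y| < e.
Proof.
split=> [/cvgrPdist_lt fx e e0|fx].
  by have /nbhs_normP[r r0 hr] := fx e e0; exists r.
apply/cvgrPdist_lt => e e0; have [r r0 hr] := fx e e0.
by apply/nbhs_normP; exists r.
Qed.

End EpsilonDelta.

Section ContinuousFunctions.
Context {R : realType} {T : topologicalType} {V : normedModType R}.

Lemma cont_add (f g : T -> V) :
  continuous f -> continuous g -> continuous (fun x => f x + g x).
Proof. by move=> cf cg x; apply: continuousD; [exact: cf|exact: cg]. Qed.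

Lemma cont_sub (f g : T -> V) :
  continuous f -> continuous g -> continuous (fun x => f x - g x).
Proof. by move=> cf cg x; apply: continuousB; [exact: cf|exact: cg]. Qed.

Lemma cont_scale (f : T -> R) (g : T -> V) :
  continuous f -> continuous g -> continuous (fun x => f x *: g x).
Proof. by move=> cf cg x; apply: continuousZ; [exact: cf|exact: cg]. Qed.

Lemma cont_mul (f g : T -> R) :
  continuous f -> continuous g -> continuous (fun x => f x * g x).
Proof. by move=> cf cg x; apply: continuousM; [exact: cf|exact: cg]. Qed.

Lemma cont_cst (c : V) : continuous (fun _ : T => c).
Proof. by move=> x; exact: cvg_cst. Qed.

Lemma cont_sum (I : Type) (s : seq I) (f : I -> T -> V) :
  (forall i, continuous (f i)) -> continuous (fun x => \sum_(i <- s) f i x).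
Proof.
move=> cf; elim: s => [|i s IH].
  by under eq_fun do rewrite big_nil; exact: cont_cst.
by under eq_fun do rewrite big_cons; exact: cont_add.
Qed.

Lemma cont_comp (T' : topologicalType) (f : T -> T') (g : T' -> V) :
  continuous f -> continuous g -> continuous (fun x => g (f x)).
Proof. by move=> cf cg x; apply: continuous_comp; [exact: cf|exact: cg]. Qed.

End ContinuousFunctions.

Section Coordinates.
Context {R : realType} {n : nat}.
Local Notation H := (herm R n).
Implicit Types X Y : H.

Lemma normhE X : `|X| = Num.sqrt (hip X X).
Proof. by []. Qed.

Lemma sqr_normh X : `|X| ^+ 2 = hip X X.
Proof. by rewrite normhE sqr_sqrtr ?hip_ge0. Qed.

Lemma hipDr X Y Y' : hip X (Y + Y') = hip X Y + hip X Y'.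
Proof. by rewrite hipC hipDl !(hipC X). Qed.

Lemma hipZr a X Y : hip X (a *: Y) = a * hip X Y.
Proof. by rewrite hipC hipZl hipC. Qed.

Lemma hip_sumr (I : Type) (s : seq I) (Q : pred I) X (Y : I -> H) :
  hip X (\sum_(i <- s | Q i) Y i) = \sum_(i <- s | Q i) hip X (Y i).
Proof.
elim/big_rec2: _ => [|i y1 y2 _ <-]; last by rewrite hipDr.
by rewrite -[0 in LHS](scale0r X) hipZr mul0r.
Qed.

Lemma hipNr X Y : hip X (- Y) = - hip X Y.
Proof. by rewrite -scaleN1r hipZr mulN1r. Qed.

Lemma hipBr X Y Y' : hip X (Y - Y') = hip X Y - hip X Y'.
Proof. by rewrite hipDr hipNr. Qed.

Lemma hip0r X : hip X 0 = 0.
Proof. by rewrite -[0](scale0r X) hipZr mul0r. Qed.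

Lemma hip0l X : hip 0 X = 0. Proof. by rewrite hipC hip0r. Qed.

Lemma hipNl X Y : hip (- X) Y = - hip X Y.
Proof. by rewrite hipC hipNr hipC. Qed.

Lemma hipBl X X' Y : hip (X - X') Y = hip X Y - hip X' Y.
Proof. by rewrite hipDl hipNl. Qed.

Lemma hip_ler_norm X Y : `|hip X Y| <= `|X| * `|Y|.
Proof.
rewrite !normhE -sqrtrM ?hip_ge0 // -sqrtr_sqr.
by rewrite ler_sqrt ?hip_CauchySchwarz // mulr_ge0 ?hip_ge0.
Qed.

Lemma hip_le_norm X Y : hip X Y <= `|X| * `|Y|.
Proof. exact: le_trans (ler_norm _) (hip_ler_norm X Y). Qed.

HB.instance Definition _ X := GRing.isZmodMorphism.Build H R (hip X) (hipBr X).
HB.instance Definition _ X :=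
  GRing.isScalable.Build R H R^o *%R (hip X) (fun a Y => hipZr a X Y).

Lemma hip_continuous X : continuous (hip X : H -> R).
Proof.
move=> Y; apply/(@continuous_atP _ H R^o) => e e0.
have X0 : 0 < `|X| + 1 by rewrite ltr_wpDl.
exists (e / (`|X| + 1)) => [|Z]; first exact: divr_gt0.
rewrite ltr_pdivlMr // => YZ.
rewrite -hipBr (le_lt_trans (hip_ler_norm _ _)) // mulrC (le_lt_trans _ YZ) //.
by rewrite ler_wpM2l // lerDl.
Qed.

Lemma hip_continuousl X : continuous ((fun Y => hip Y X) : H -> R).
Proof. by under eq_fun do rewrite hipC; exact: hip_continuous. Qed.

(* The coordinates of X are the entries of the real matrix Re X + Im X. Since
   Re X is symmetric and Im X is antisymmetric they determine X. *)
Definition hcoord X : 'rV[R]_(n * n) :=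
  mxvec (\matrix_(i, j) (complex.Re (hmx X i j) + complex.Im (hmx X i j))).

Lemma hvec_subproof (u : 'rV[R]_(n * n)) :
  selfadjoint (\matrix_(i, j)
    (((vec_mx u i j + vec_mx u j i) / 2) +i*
     ((vec_mx u i j - vec_mx u j i) / 2)) : 'M[R[i]]_n).
Proof.
rewrite selfadjointE; apply/eqP/matrixP => i j; rewrite !mxE.
apply/eqP; rewrite eq_complex /=; apply/andP; split; apply/eqP; lra.
Qed.

Definition hvec u : H := Herm (hvec_subproof u).

Lemma hcoordK X : hvec (hcoord X) = X.
Proof.
apply/val_inj/matrixP => i j; rewrite [LHS]mxE /hcoord mxvecK !mxE.
have := herm_entry X i j; case: (hmx X i j) => a b; case: (hmx X j i) => c e.
by move=> [-> ->] /=; apply/eqP; rewrite eq_complex /=; apply/andP; split; apply/eqP; lra.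
Qed.

Lemma hvecK u : hcoord (hvec u) = u.
Proof.
apply: (can_inj vec_mxK); rewrite /hcoord mxvecK; apply/matrixP => i j.
rewrite [LHS]mxE [hmx _ i j]mxE /=; lra.
Qed.

Lemma hcoord_is_linear : linear hcoord.
Proof.
move=> a X Y; rewrite /hcoord -linearP; congr mxvec; apply/matrixP => i j.
rewrite !mxE /=.
by case: (hmx X i j) => b c; case: (hmx Y i j) => e f /=; ring.
Qed.
HB.instance Definition _ := GRing.isLinear.Build _ _ _ _ hcoord hcoord_is_linear.

Lemma hvec_is_linear : linear hvec.
Proof.
by move=> a u v; apply: (can_inj hcoordK); rewrite linearP /= !hvecK.
Qed.
HB.instance Definition _ := GRing.isLinear.Build _ _ _ _ hvec hvec_is_linear.

(** Expanding the products of coordinates gives the trace plus cross terms Re X Im Y + Im X Re Y.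
    The latter are antisymmetric in the indices, so their sum vanishes; hence [hcoord] is an
    isometry. *)
Lemma hip_hcoord X Y : hip X Y = \sum_k hcoord X 0 k * hcoord Y 0 k.
Proof.
have -> : \sum_k hcoord X 0 k * hcoord Y 0 k =
    \sum_i \sum_j (complex.Re (hmx X i j) + complex.Im (hmx X i j)) *
                  (complex.Re (hmx Y i j) + complex.Im (hmx Y i j)).
  rewrite pair_bigA (reindex _ (curry_mxvec_bij _ _)) /=.
  by apply: eq_bigr => -[i j] _ /=; rewrite !mxvecE !mxE.
pose f i j := complex.Re (hmx X i j) * complex.Re (hmx Y i j) +
              complex.Im (hmx X i j) * complex.Im (hmx Y i j).
pose g i j := complex.Re (hmx X i j) * complex.Im (hmx Y i j) +
              complex.Im (hmx X i j) * complex.Re (hmx Y i j).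
have -> : hip X Y = \sum_i \sum_j f i j.
  rewrite /hip /mxtrace raddf_sum /=; apply: eq_bigr => i _.
  rewrite mxE raddf_sum /=; apply: eq_bigr => j _.
  rewrite (herm_entry Y j i) /f.
  by case: (hmx X i j) => a b; case: (hmx Y i j) => c e /=; lra.
have g0 : \sum_i \sum_j g i j = 0.
  suff : \sum_i \sum_j g i j = - \sum_i \sum_j g i j by lra.
  rewrite [in RHS]exchange_big /= -sumrN; apply: eq_bigr => i _.
  rewrite -sumrN; apply: eq_bigr => j _.
  rewrite /g (herm_entry X j i) (herm_entry Y j i).
  by case: (hmx X i j) => a b; case: (hmx Y i j) => c e /=; lra.
transitivity (\sum_i \sum_j f i j + \sum_i \sum_j g i j); first by rewrite g0 addr0.
rewrite -big_split /=; apply: eq_bigr => i _.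
rewrite -big_split /=; apply: eq_bigr => j _; rewrite /f /g; lra.
Qed.

(** Preimages of the standard basis under the isometry [hcoord], hence orthonormal. *)
Definition hbasis (k : 'I_(n * n)) : H := hvec (delta_mx 0 k).

Lemma hip_hbasis X k : hip X (hbasis k) = hcoord X 0 k.
Proof.
rewrite hip_hcoord hvecK (bigD1 k) //= big1 ?addr0 ?mxE ?eqxx ?mulr1 //.
by move=> l /negbTE lk; rewrite mxE lk andbF mulr0.
Qed.

Lemma hvecE (u : 'rV[R]_(n * n)) : hvec u = \sum_k u 0 k *: hbasis k.
Proof.
rewrite {1}[u]row_sum_delta linear_sum /=.
by apply: eq_bigr => k _; rewrite linearZ.
Qed.

Lemma hip_decomp X : X = \sum_k hip X (hbasis k) *: hbasis k.
Proof.
by rewrite -[LHS]hcoordK hvecE; apply: eq_bigr => k _; rewrite hip_hbasis.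
Qed.

Lemma hmx_decomp X k l :
  hmx X k l = \sum_a (hip X (hbasis a))%:C * hmx (hbasis a) k l.
Proof.
rewrite {1}[X]hip_decomp; elim/big_rec2: _ => [|a y Y _ yY]; first by rewrite mxE.
by rewrite hmxD mxE yY hmxZ mxE.
Qed.

Lemma hip_sum X Y : hip X Y = \sum_k hip X (hbasis k) * hip Y (hbasis k).
Proof. by rewrite hip_hcoord; apply: eq_bigr => k _; rewrite !hip_hbasis. Qed.

Lemma hvec_continuous : continuous (hvec : 'rV[R]_(n * n) -> H).
Proof.
have -> : hvec = (fun u => \sum_k u 0 k *: hbasis k).
  by apply/funext => u; rewrite hvecE.
apply: cont_sum => k; apply: cont_scale; last exact: cont_cst.
exact: coord_continuous.
Qed.

Lemma herm_compact (A : set H) : bounded_set A -> closed A -> compact A.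
Proof.
move=> [M [_ hM]] Acl.
pose B : set 'rV[R]_(n * n) := [set u | A (hvec u)].
have cB : compact B.
  apply: bounded_closed_compact; last first.
    by apply: preimage_closed => // u _; exact: hvec_continuous.
  (* Boundedness only speaks of bounds strictly larger than [M], hence [M + 1]. *)
  exists (M + 1); split; first exact: num_real.
  move=> x Mx u /= Au.
  have M1 : `|hvec u| <= M + 1 by apply: hM => //; lra.
  have M0 : 0 <= M + 1 by exact: le_trans M1.
  apply: le_trans (ltW Mx).
  rewrite [leLHS]/Num.norm /= mx_normrE; apply: bigmax_le => // -[i k] _ /=.
  rewrite ord1 -[u]hvecK -hip_hbasis; apply: le_trans M1.
  rewrite -(@ler_pXn2r _ 2) ?nnegrE // sqr_normh (hip_sum (hvec u) (hvec u)) (bigD1 k) //=.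
  rewrite real_normK ?num_real // expr2.
  by rewrite lerDl sumr_ge0 // => l _; rewrite -expr2 sqr_ge0.
have -> : A = hvec @` B.
  apply/seteqP; split=> [X AX | _ [u Bu <-]] //.
  by exists (hcoord X); rewrite /B /= ?hcoordK.
by apply: continuous_compact => //; apply: continuous_subspaceT; exact: hvec_continuous.
Qed.

End Coordinates.

(** * Product states *)

Section Adjoint.
Context {C : numClosedFieldType}.

Lemma adjmxZ m n a (A : 'M[C]_(m, n)) : (a *: A)^t* = Num.conj a *: A^t*.
Proof. by apply/matrixP => i j; rewrite !mxE rmorphM. Qed.

Lemma adjmxD m n (A B : 'M[C]_(m, n)) : (A + B)^t* = A^t* + B^t*.
Proof. by apply/matrixP => i j; rewrite !mxE rmorphD. Qed.

Lemma adjmxM m n p (A : 'M[C]_(m, n)) (B : 'M[C]_(n, p)) :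
  (A *m B)^t* = B^t* *m A^t*.
Proof. by rewrite trmx_mul map_mxM. Qed.

Lemma adjmx_delta m n (i : 'I_m) (j : 'I_n) :
  (delta_mx i j : 'M[C]_(m, n))^t* = delta_mx j i.
Proof. by rewrite trmx_delta map_delta_mx. Qed.

End Adjoint.

(** * Rank-one projectors: normal form, unitary transitivity, spanning *)

Section RankOneProjectors.
Context {R : realType} {n : nat}.
Local Notation C := R[i].
Implicit Types p q : 'M[C]_n.

Lemma hermsymmxE p : (p \is hermsymmx) = (p == p^t*).
Proof. exact: selfadjointE. Qed.

(** Write p = V W with V of full column rank and W of full row rank. Cancelling in V W V W = V W
    leaves W V = 1, whose size is the rank and whose trace is that of p. *)
Lemma idem_trace_rank p : p *m p = p -> \tr p = (\rank p)%:R.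
Proof.
move=> pp; have [L LC] := row_fullP (col_base_full p).
have [B BR] := row_freeP (row_base_free p).
rewrite -{1}[p]mulmx_base mxtrace_mulC.
suff -> : row_base p *m col_base p = 1%:M by rewrite mxtrace1.
set V := col_base p in LC *; set W := row_base p in BR *.
have : L *m ((V *m W) *m (V *m W)) *m B = L *m (V *m W) *m B by rewrite mulmx_base pp.
by clearbody V W; rewrite !mulmxA LC !mul1mx -!mulmxA BR mulmx1.
Qed.

Lemma rank_one_projectorP p : p \is hermsymmx -> p *m p = p -> \tr p = 1 ->
  rank_one_projector p.
Proof.
move=> hp pp; rewrite (idem_trace_rank pp) => /eqP.
by rewrite pnatr_eq1 => /eqP p1.
Qed.

Lemma rank_one_trace p : rank_one_projector p -> \tr p = 1.
Proof. by case=> _ pp p1; rewrite (idem_trace_rank pp) p1. Qed.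

Lemma dot_row_ge0 (u : 'rV[C]_n) : 0 <= (u *m u^t*) 0 0.
Proof.
rewrite mxE; apply: sumr_ge0 => j _; rewrite !mxE; exact: mul_conjC_ge0.
Qed.

Lemma dot_row_eq0 (u : 'rV[C]_n) : ((u *m u^t*) 0 0 == 0) = (u == 0).
Proof.
apply/eqP/eqP => [|->]; last by rewrite mul0mx mxE.
rewrite mxE => u0; apply/rowP => j; rewrite [RHS]mxE.
have /eqP := u0; rewrite psumr_eq0 => [|k _]; last first.
  by rewrite !mxE; exact: mul_conjC_ge0.
move/allP/(_ j); rewrite mem_index_enum => /(_ isT) /=.
by rewrite !mxE mul_conjC_eq0 => /eqP.
Qed.

(** Rank one gives p = a b with b a row, and p equals its adjoint times itself, so p is c >= 0 times
    the adjoint of b times b; u is b scaled by the square root of c. Comparing the traces of p p and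
    p shows that the squared norm of u is 0 or 1, and rank one excludes 0. *)
Lemma rank_one_row p : rank_one_projector p ->
  exists2 u : 'rV[C]_n, u *m u^t* = 1%:M & p = u^t* *m u.
Proof.
move=> [hp pp p1].
have /rowV0Pn[b bp b0] : p != 0 by rewrite -mxrank_eq0 p1.
have /submxP[a pE] : (p <= b)%MS.
  by rewrite -(geq_leqif (mxrank_leqif_sup bp)) p1 rank_rV b0.
have pab : p = (a^t* *m a) 0 0 *: (b^t* *m b).
  rewrite -{1}pp; move: hp; rewrite hermsymmxE => /eqP {1}->.
  rewrite pE adjmxM mulmxA -[_ *m a]mulmxA.
  by rewrite [a^t* *m a]mx11_scalar mul_mx_scalar -scalemxAl !mxE eqxx mulr1n.
have c0 : 0 <= (a^t* *m a) 0 0.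
  by have := dot_row_ge0 (a^t*); rewrite trmxCK.
move: pab; set c := _ 0 0 in c0 *; move=> pab.
pose u := sqrtC c *: b.
have pu : p = u^t* *m u.
  rewrite pab /u adjmxZ -scalemxAl -scalemxAr scalerA.
  by rewrite geC0_conj ?sqrtC_ge0 // -expr2 sqrtCK.
pose s := (u *m u^t*) 0 0; have us : u *m u^t* = s%:M by exact: mx11_scalar.
exists u; rewrite // us; congr (_%:M).
have /(congr1 mxtrace) := pp.
rewrite pu mulmxA -[u^t* *m _ *m _]mulmxA us mul_mx_scalar.
rewrite -scalemxAl linearZ /= mxtrace_mulC us mxtrace_scalar mulr1n => /eqP.
rewrite -subr_eq0 -[X in _ - X]mul1r -mulrBl.
rewrite mulf_eq0 subr_eq0 => /orP[/eqP //|].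
rewrite /s dot_row_eq0 => /eqP u0; move: p1.
by rewrite pu u0 mulmx0 mxrank0.
Qed.

Lemma rank_one_diag p : rank_one_projector p ->
  exists2 S : 'M[C]_n, S \is unitarymx &
    forall i : 'I_n, i = 0 :> nat -> p = S^t* *m delta_mx i i *m S.
Proof.
move=> /rank_one_row[u u1 pu].
(* Gram-Schmidt turns this matrix into a unitary one; only its first row matters, which spans the
   line of [u] and so equals [u] up to a phase. The phase cancels in the projector. *)
pose A : 'M[C]_n := \matrix_(i, j) u 0 j.
exists (schmidt A); first by rewrite schmidt_unitarymx.
move=> i i0; set S := schmidt A.
have Su : S \is unitarymx by rewrite schmidt_unitarymx.
have /sub_rVP[c uc] : (u <= row i S)%MS.
  have -> : u = row i A by apply/rowP => j; rewrite !mxE.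
  apply: submx_trans (row_schmidt_sub _ _) _.
  apply/sumsmx_subP => k; rewrite i0 leqn0 => /eqP k0.
  by rewrite genmxE (_ : k = i) //; apply/val_inj; rewrite /= k0.
have ri : row i S *m (row i S)^t* = 1%:M.
  apply/matrixP => k l; rewrite !ord1 -[in LHS]dotmxE.
  by have /row_unitarymxP -> := Su; rewrite eqxx mxE.
have cc : c * Num.conj c = 1.
  move: u1; rewrite uc adjmxZ -scalemxAl -scalemxAr ri scalerA.
  by move/matrixP/(_ 0 0); rewrite !mxE eqxx mulr1.
rewrite pu uc adjmxZ -scalemxAl -scalemxAr scalerA mulrC cc scale1r.
rewrite rowE adjmxM adjmx_delta -!mulmxA; congr (_ *m _).
by rewrite mulmxA mul_delta_mx.
Qed.

Lemma rank_one_transitive p q : rank_one_projector p -> rank_one_projector q ->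
  exists2 U : 'M[C]_n, U \is unitarymx & U *m p *m U^t* = q.
Proof.
move=> hp hq; have [S Su pS] := rank_one_diag hp; have [T Tu qT] := rank_one_diag hq.
have [n0|n0] := posnP n.
  by exists 1%:M; [apply/unitarymxP; rewrite trmx1 map_mx1 mulmx1|
     apply/matrixP => i; have := ltn_ord i; rewrite [X in (_ < X)%N]n0].
pose i := Ordinal n0.
have Tu' : T^t* \is unitarymx by rewrite trmxC_unitary.
exists (T^t* *m S).
  exact: mul_unitarymx Tu' Su.
rewrite (pS i) // (qT i) // adjmxM trmxCK.
rewrite -!mulmxA; congr (_ *m _); rewrite !mulmxA (unitarymxP Su) mul1mx.
by rewrite -[_ *m S *m _]mulmxA (unitarymxP Su) mulmx1.
Qed.

(** Polarization: g vanishes on every multiple of a rank-one projector, in particular on the one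
    given by e_i + z e_j; the values 1 and i of z isolate the matrix units. *)
Lemma linear_rank_one_eq0 (g : 'M[C]_n -> C) :
  (forall a A B, g (a *: A + B) = a * g A + g B) ->
  (forall p, rank_one_projector p -> g p = 0) -> forall A, g A = 0.
Proof.
move=> gl gp.
have g0 : g 0 = 0 by have := gl (-1) 0 0; rewrite scaler0 addr0 mulN1r addNr.
have gD A B : g (A + B) = g A + g B by rewrite -{1}[A]scale1r gl mul1r.
have gZ a A : g (a *: A) = a * g A by rewrite -[_ *: _]addr0 gl g0 addr0.
have gv (v : 'rV[C]_n) : g (v^t* *m v) = 0.
  have [->|v0] := eqVneq v 0; first by rewrite mulmx0.
  pose s := (v *m v^t*) 0 0.
  have s0 : s != 0 by rewrite /s dot_row_eq0.
  have sc : Num.conj s = s by rewrite geC0_conj // dot_row_ge0.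
  have scV : Num.conj s^-1 = s^-1 by rewrite fmorphV; congr (_^-1); exact: sc.
  have -> : v^t* *m v = s *: (s^-1 *: (v^t* *m v)) by rewrite scalerA mulfV // scale1r.
  rewrite gZ gp ?mulr0 //; apply: rank_one_projectorP.
  - by rewrite hermsymmxE adjmxZ adjmxM trmxCK scV.
  - rewrite -scalemxAl -scalemxAr scalerA mulmxA -[v^t* *m _ *m _]mulmxA.
    rewrite [v *m _]mx11_scalar -/s mul_mx_scalar -scalemxAl scalerA.
    by rewrite mulrAC mulVf // mul1r.
  - by rewrite linearZ /= mxtrace_mulC [v *m _]mx11_scalar mxtrace_scalar mulr1n mulVf.
have gz i j (z : C) : z * g (delta_mx i j) + Num.conj z * g (delta_mx j i) = 0.
  have := gv (delta_mx 0 i + z *: delta_mx 0 j).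
  rewrite adjmxD adjmxZ !adjmx_delta.
  rewrite mulmxDl mulmxDr [X in _ + X]mulmxDr -!scalemxAl -!scalemxAr !mul_delta_mx.
  rewrite !gD !gZ.
  have gd k : g (delta_mx k k) = 0.
    by have := gv (delta_mx 0 k); rewrite adjmx_delta mul_delta_mx.
  by rewrite !gd !mulr0 add0r addr0.
have gd i j : g (delta_mx i j) = 0.
  have h1 := gz i j 1; have hi := gz i j 'i.
  rewrite rmorph1 !mul1r in h1; rewrite conjCi mulNr -mulrBr in hi.
  move/eqP: hi; rewrite mulf_eq0 (negbTE (neq0Ci _)) subr_eq0 /= => /eqP hi.
  by move/eqP: h1; rewrite -hi -mulr2n mulrn_eq0 /= => /eqP.
move=> A; rewrite [A]matrix_sum_delta.
elim/big_rec: _ => [|i B _ gB] //; rewrite gD gB addr0.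
by elim/big_rec: _ => [|j B' _ gB'] //; rewrite gD gB' gZ gd mulr0 addr0.
Qed.

End RankOneProjectors.

(** * Tensor products of families of matrices *)

Section Tensor.
Context {R : realType} {N : nat} {d : 'I_N -> nat}.
Local Notation C := R[i].
Local Notation n := (tensor_dim d).
Local Notation mats := (forall I, 'M[C]_(d I)).
Implicit Types A B : mats.

(** Distributivity when the range of summation varies with the factor: the dependent family is
    rewritten over tagged indices, where the general distributivity law applies. *)
Lemma prod_sum_multi_index (F : forall I, 'I_(d I) -> C) :
  \prod_I \sum_j F I j = \sum_(f : multi_index d) \prod_I F I (f I).
Proof.
rewrite (reindex (@dffun_of_fprod _ _)) /=; last first.
  exact/onW_bij/dffun_of_fprod_bij.
have -> : \sum_(f : fprod (fun I => 'I_(d I)))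
      \prod_I F I (dffun_of_fprod f I) =
    \sum_(f : fprod (fun I => 'I_(d I)))
      \prod_(I in 'I_N) [ffun j => F I j] (f I).
  by apply: eq_bigr => f _; apply: eq_bigr => I _; rewrite !ffunE.
rewrite big_fprod.
transitivity (\prod_I \sum_(u in tagged_with (fun I => 'I_(d I)) I)
    untag 0 [ffun j => F I j] u); last exact: bigA_distr_big_dep.
apply: eq_bigr => I _; rewrite -(big_tag (fun I : 'I_N => [ffun j => F I j])).
by apply: eq_bigr => j _; rewrite ffunE.
Qed.

Lemma sum_tensor_index (F : multi_index d -> C) :
  \sum_(k < n) F (enum_val k) = \sum_f F f.
Proof. by rewrite [RHS](reindex _ (onW_bij _ (enum_val_bij _))). Qed.

Lemma tensor_mxM A B :
  tensor_mx A *m tensor_mx B = tensor_mx (fun I => A I *m B I).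
Proof.
apply/matrixP => k l; rewrite !mxE.
pose F (f : multi_index d) :=
  \prod_I (A I ((enum_val k : multi_index d) I) (f I) *
           B I (f I) ((enum_val l : multi_index d) I)).
transitivity (\sum_(j < n) F (enum_val j)).
  by apply: eq_bigr => j _; rewrite !mxE -big_split.
rewrite sum_tensor_index -(prod_sum_multi_index (fun I j =>
  A I ((enum_val k : multi_index d) I) j * B I j ((enum_val l : multi_index d) I))).
by apply: eq_bigr => I _; rewrite mxE.
Qed.

Lemma tensor_mx_adj A : (tensor_mx A)^t* = tensor_mx (fun I => (A I)^t*).
Proof.
apply/matrixP => k l; rewrite !mxE rmorph_prod.
by apply: eq_bigr => I _; rewrite !mxE.
Qed.

Lemma tensor_mx_delta (f g : multi_index d) :
  tensor_mx (fun I => delta_mx (f I) (g I) : 'M[C]_(d I)) =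
  delta_mx (enum_rank f) (enum_rank g).
Proof.
have prodE (h h' : multi_index d) :
    \prod_I ((h I == h' I)%:R : C) = (h == h')%:R.
  have [->|hh'] := eqVneq h h'; first by rewrite big1 // => I _; rewrite eqxx.
  have [I hI] : exists I, h I != h' I.
    apply/existsP; apply: contraNT hh'; rewrite negb_exists => /forallP hh'.
    by apply/eqP/ffunP => I; apply/eqP; have := hh' I; rewrite negbK.
  by rewrite (bigD1 I) //= (negbTE hI) mul0r.
apply/matrixP => k l; rewrite !mxE.
transitivity (((enum_val k : multi_index d) == f)%:R *
              ((enum_val l : multi_index d) == g)%:R : C).
  rewrite -!prodE -big_split; apply: eq_bigr => I _; rewrite !mxE /=.
  by rewrite -natrM mulnb.
have rk (m : 'I_n) (h : multi_index d) :
    ((enum_val m : multi_index d) == h) = (m == enum_rank h).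
  by apply/eqP/eqP => [<-|->]; [rewrite enum_valK|rewrite enum_rankK].
by rewrite !rk -natrM mulnb.
Qed.

Lemma tensor_mx1 : tensor_mx (fun I => 1%:M : 'M[C]_(d I)) = 1%:M.
Proof.
apply/matrixP => k l; rewrite !mxE.
have [->|kl] := eqVneq k l; first by rewrite big1 // => I _; rewrite mxE eqxx.
have [I hI] : exists I, (enum_val k : multi_index d) I != (enum_val l : multi_index d) I.
  apply/existsP; apply: contraNT kl; rewrite negb_exists => /forallP hh'.
  apply/eqP/enum_val_inj/ffunP => I; apply/eqP; have := hh' I; rewrite negbK //.
by rewrite (bigD1 I) //= mxE (negbTE hI) mul0r.
Qed.

Lemma mxtrace_tensor A : \tr (tensor_mx A) = \prod_I \tr (A I).
Proof.
rewrite prod_sum_multi_index -sum_tensor_index.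
by apply: eq_bigr => k _; rewrite mxE.
Qed.

Lemma tensor_mx_unitary A : (forall I, A I \is unitarymx) ->
  tensor_mx A \is unitarymx.
Proof.
move=> hA; apply/unitarymxP; rewrite tensor_mx_adj tensor_mxM -tensor_mx1.
have -> : (fun I => A I *m (A I)^t*) = (fun I => 1%:M : 'M[C]_(d I)).
  by apply: functional_extensionality_dep => I; apply/unitarymxP; exact: hA.
exact: erefl.
Qed.

(** Multilinearity, with [dfwith] replacing a single factor; it allows arguing one factor at a
    time. *)
Lemma tensor_mx_linear A I a (B B' : 'M[C]_(d I)) :
  tensor_mx (dfwith A I (a *: B + B')) =
  a *: tensor_mx (dfwith A I B) + tensor_mx (dfwith A I B').
Proof.
apply/matrixP => k l; rewrite !mxE.
rewrite (bigD1 I) //= [X in _ = _ * X + _](bigD1 I) //= [X in _ = _ + X](bigD1 I) //=.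
rewrite !dfwithin !mxE mulrDl mulrA.
by congr (_ * _ + _ * _); apply: eq_bigr => J JI; rewrite !dfwithout // eq_sym.
Qed.

Lemma tensor_hermsymmx A : (forall I, A I \is hermsymmx) -> selfadjoint (tensor_mx A).
Proof.
move=> hA; rewrite selfadjointE tensor_mx_adj; apply/eqP; congr tensor_mx.
by apply: functional_extensionality_dep => I; apply/eqP; rewrite -hermsymmxE.
Qed.

End Tensor.

Section Identity.
Context {R : realType} {n : nat}.
Local Notation H := (herm R n).
Implicit Types X Y : H.

(** The trace is the inner product with this operator, so the conditions of trace 0 and trace 1
    become linear equations over the reals. *)
Definition hone : H := Herm (hermitian1mx_subproof n).

Lemma trace_hone X : \tr (hmx X) = (hip hone X)%:C.
Proof. by rewrite hip_trace mul1mx. Qed.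

Lemma tracelessP X : traceless R n X <-> hip hone X = 0.
Proof.
rewrite /traceless /= trace_hone; split=> [h|->//].
by apply: complexI; rewrite h.
Qed.

Lemma trace_oneP X : trace_one R n X <-> hip hone X = 1.
Proof.
rewrite /trace_one /= trace_hone; split=> [h|->//].
by apply: complexI; rewrite h.
Qed.

Lemma unitary_conj_norm (U : 'M[R[i]]_n) X : U \is unitarymx ->
  `|conj_herm U X| = `|X|.
Proof.
move=> Uu; rewrite !normhE; congr Num.sqrt; apply: complexI; rewrite !hip_trace /=.
have UU : U^t* *m U = 1%:M.
  by move: Uu; rewrite -trmxC_unitary => /unitarymxP; rewrite trmxCK.
rewrite -!mulmxA [U^t* *m (U *m _)]mulmxA UU mul1mx mxtrace_mulC.
by rewrite -!mulmxA UU mulmx1.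
Qed.

Lemma conj_hermB (U : 'M[R[i]]_n) X Y :
  conj_herm U (X - Y) = conj_herm U X - conj_herm U Y.
Proof. by apply: val_inj; rewrite /= mulmxBr mulmxBl. Qed.

Lemma conj_herm_continuous (U : 'M[R[i]]_n) : U \is unitarymx ->
  continuous (conj_herm U : H -> H).
Proof.
move=> Uu X; apply/(@continuous_atP _ H H) => e e0; exists e; first exact: e0.
move=> Y XY; have := unitary_conj_norm (X - Y) Uu; rewrite conj_hermB => XYE.
by rewrite [X in X < _]XYE.
Qed.

End Identity.

(** * Product states: norm, positivity, transitivity, separation *)

Section ProductStatesFacts.
Context {R : realType} {N : nat} {d : 'I_N -> nat}.
Local Notation C := R[i].
Local Notation n := (tensor_dim d).
Local Notation H := (herm R n).
Local Notation P := (product_states R d).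

Definition tensor_herm (p : forall I, 'M[C]_(d I))
  (hp : forall I, p I \is hermsymmx) : H := Herm (tensor_hermsymmx hp).

Lemma product_states_trace (X : H) : P X -> hip hone X = 1.
Proof.
case=> p [hp Xp]; apply: complexI; rewrite -trace_hone Xp mxtrace_tensor.
by rewrite big1 // => I _; rewrite rank_one_trace.
Qed.

Lemma product_states_idem (X : H) : P X -> hmx X *m hmx X = hmx X.
Proof.
case=> p [hp ->]; rewrite tensor_mxM; congr tensor_mx.
by apply: functional_extensionality_dep => I; have [] := hp I.
Qed.

Lemma product_states_norm (X : H) : P X -> `|X| = 1.
Proof.
move=> PX; rewrite normhE -[RHS]sqrtr1; congr Num.sqrt; apply: complexI.
by rewrite hip_trace product_states_idem // trace_hone product_states_trace.
Qed.

Lemma product_states_psd (X : H) : P X -> psd X.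
Proof.
move=> PX v; rewrite -product_states_idem //.
have /eqP {1}-> : hmx X == (hmx X)^t* by rewrite -selfadjointE hmxP.
have := dot_row_ge0 ((hmx X *m v)^t*).
by rewrite trmxCK adjmxM -!mulmxA.
Qed.

Lemma product_states_transitive (X Y : H) : P X -> P Y ->
  exists U : forall I, 'M[C]_(d I), (forall I, U I \is unitarymx) /\
    conj_herm (tensor_mx U) X = Y.
Proof.
case=> p [hp Xp] [q [hq Yq]].
pose hU I := cid2 (rank_one_transitive (hp I) (hq I)).
exists (fun I => s2val (hU I)); split=> [I|]; first by case: (hU I).
apply: val_inj; rewrite /= Xp Yq tensor_mx_adj !tensor_mxM; congr tensor_mx.
by apply: functional_extensionality_dep => I; case: (hU I).
Qed.

(** The functional [f] is multilinear in the factors and vanishes on families of projectors. The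
    factors are freed one at a time, since rank-one projectors span all matrices; matrix units then
    give the entries of [Y]. *)
Lemma product_states_separating (Y : H) :
  (forall p, P p -> hip Y p = 0) -> Y = 0.
Proof.
move=> YP; pose f (A : forall I, 'M[C]_(d I)) := \tr (hmx Y *m tensor_mx A).
have fP (A : forall I, 'M[C]_(d I)) : (forall I, rank_one_projector (A I)) -> f A = 0.
  move=> hA; have hA' I : A I \is hermsymmx by have [] := hA I.
  by rewrite /f -[tensor_mx A]/(hmx (tensor_herm hA')) -hip_trace YP //; exists A.
(* The factors of index below [k] are arbitrary, the others are still projectors. *)
have fk k : forall A : forall I, 'M[C]_(d I),
    (forall I : 'I_N, (k <= I)%N -> rank_one_projector (A I)) -> f A = 0.
  elim: k => [|k IH] A hA; first by apply: fP => I; exact: hA.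
  have [Nk|kN] := leqP N k.
    by apply: IH => I kI; have := leq_trans Nk kI; rewrite leqNgt ltn_ord.
  pose I0 := Ordinal kN.
  have -> : A = dfwith A I0 (A I0).
    by apply: functional_extensionality_dep => I; case: dfwithP.
  apply: (@linear_rank_one_eq0 R (d I0) (fun B => f (dfwith A I0 B))) => [a B B'|B hB].
    by rewrite /f tensor_mx_linear mulmxDr -scalemxAr linearD linearZ.
  apply: IH => I; case: dfwithP => // J JI kI; apply: hA.
  by rewrite ltn_neqAle kI andbT -[k]/(I0 : nat).
apply/val_inj/matrixP => k l; rewrite [RHS]mxE.
have := fk N (fun I => delta_mx ((enum_val l : multi_index d) I)
                               ((enum_val k : multi_index d) I)).
rewrite /f tensor_mx_delta !enum_valK => <-; last first.
  by move=> I; rewrite leqNgt ltn_ord.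
rewrite mxtrace_mulC /mxtrace (bigD1 l) //= big1 ?addr0 => [|i il].
  rewrite mxE (bigD1 k) //= big1 ?addr0 => [|j jk]; first by rewrite !mxE !eqxx mul1r.
  by rewrite mxE (negbTE jk) andbF mul0r.
by rewrite mxE big1 // => j _; rewrite mxE (negbTE il) mul0r.
Qed.

End ProductStatesFacts.

Section ComplexContinuity.
Context {R : realType} {T : topologicalType}.
Local Notation C := R[i].

(* Stated on the two components because the library does not relate the topology
   of R[i] to the one of R. *)
Definition ccontinuous (f : T -> C) : Prop :=
  continuous (fun x => complex.Re (f x)) /\ continuous (fun x => complex.Im (f x)).

Lemma ccont_cst (c : C) : ccontinuous (fun _ => c).
Proof. by split; exact: (@cont_cst R T R^o). Qed.

Lemma ccont_add (f g : T -> C) : ccontinuous f -> ccontinuous g ->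
  ccontinuous (fun x => f x + g x).
Proof.
move=> [f1 f2] [g1 g2]; split; under eq_fun do rewrite raddfD /=.
  exact: (@cont_add R T R^o).
exact: (@cont_add R T R^o).
Qed.

Lemma ccont_mul (f g : T -> C) : ccontinuous f -> ccontinuous g ->
  ccontinuous (fun x => f x * g x).
Proof.
move=> [f1 f2] [g1 g2]; split.
  have -> : (fun x => complex.Re (f x * g x)) = (fun x =>
      complex.Re (f x) * complex.Re (g x) +
      (-1) * complex.Im (f x) * complex.Im (g x)).
    by apply/funext => x; case: (f x) => a b; case: (g x) => c e /=; ring.
  apply: (@cont_add R T R^o); apply: cont_mul => //.
  by apply: cont_mul => //; exact: (@cont_cst R T R^o).
have -> : (fun x => complex.Im (f x * g x)) = (fun x =>
    complex.Re (f x) * complex.Im (g x) + complex.Im (f x) * complex.Re (g x)).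
  by apply/funext => x; case: (f x) => a b; case: (g x) => c e /=; ring.
by apply: (@cont_add R T R^o); apply: cont_mul.
Qed.

Lemma ccont_conj (f : T -> C) : ccontinuous f -> ccontinuous (fun x => Num.conj (f x)).
Proof.
move=> [f1 f2]; split.
  have -> // : (fun x => complex.Re (Num.conj (f x))) = (fun x => complex.Re (f x)).
  by apply/funext => x; case: (f x).
have -> : (fun x => complex.Im (Num.conj (f x))) = (fun x => (-1) * complex.Im (f x)).
  by apply/funext => x; rewrite mulN1r; case: (f x).
by apply: cont_mul => //; exact: (@cont_cst R T R^o).
Qed.

Lemma ccont_sum (I : Type) (s : seq I) (f : I -> T -> C) :
  (forall i, ccontinuous (f i)) -> ccontinuous (fun x => \sum_(i <- s) f i x).
Proof.
move=> cf; elim: s => [|i s IH].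
  by under eq_fun do rewrite big_nil; exact: ccont_cst.
by under eq_fun do rewrite big_cons; exact: ccont_add.
Qed.

Lemma ccont_prod (I : Type) (s : seq I) (f : I -> T -> C) :
  (forall i, ccontinuous (f i)) -> ccontinuous (fun x => \prod_(i <- s) f i x).
Proof.
move=> cf; elim: s => [|i s IH].
  by under eq_fun do rewrite big_nil; exact: ccont_cst.
by under eq_fun do rewrite big_cons; exact: ccont_mul.
Qed.

Lemma closed_zeros (I : Type) (f : I -> T -> R) : (forall i, continuous (f i)) ->
  closed [set x | forall i, f i x = 0].
Proof.
move=> cf.
have -> : [set x | forall i, f i x = 0] = \bigcap_i (f i @^-1` [set 0]).
  by apply/seteqP; split=> [x h i _|x h i]; exact: h.
apply: closed_bigI => i _; apply: preimage_closed; last exact: closed_eq.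
by move=> x _; exact: cf.
Qed.

Lemma closed_czeros (I : Type) (f g : I -> T -> C) :
  (forall i, ccontinuous (f i)) -> (forall i, ccontinuous (g i)) ->
  closed [set x | forall i, f i x = g i x].
Proof.
move=> cf cg.
pose h i x := f i x + (-1) * g i x.
have ch i : ccontinuous (h i).
  by apply: ccont_add => //; apply: ccont_mul => //; exact: ccont_cst.
have -> : [set x | forall i, f i x = g i x] =
    [set x | forall i, complex.Re (h i x) = 0] `&`
    [set x | forall i, complex.Im (h i x) = 0].
  apply/seteqP; split=> x /=.
    by move=> fg; split=> i; rewrite /h fg mulN1r subrr.
  move=> [h1 h2] i; apply/eqP; rewrite -subr_eq0 -mulN1r eq_complex.
  by rewrite [complex.Re _]h1 [complex.Im _]h2 !eqxx.
by apply: closedI; apply: closed_zeros => i; have [] := ch i.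
Qed.

End ComplexContinuity.

Section ProductStatesClosed.
Context {R : realType} {N : nat} {d : 'I_N -> nat}.
Local Notation C := R[i].
Local Notation n := (tensor_dim d).
Local Notation H := (herm R n).
Local Notation P := (product_states R d).

Lemma ccont_hmx k l : ccontinuous (fun X : H => hmx X k l).
Proof.
under eq_fun do rewrite hmx_decomp.
apply: ccont_sum => a; apply: ccont_mul; last exact: ccont_cst.
by split => /=; [exact: hip_continuousl | exact: (@cont_cst R H R^o)].
Qed.

(* The partial trace of X over all the factors but the I-th one. *)
Definition marginal (X : H) I : 'M[C]_(d I) :=
  \matrix_(i, j) \tr (hmx X *m
    tensor_mx (dfwith (fun J => 1%:M : 'M[C]_(d J)) I (delta_mx j i))).

Lemma ccont_marginal I i j : ccontinuous (fun X => marginal X I i j).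
Proof.
under eq_fun do rewrite mxE.
apply: ccont_sum => k; under eq_fun do rewrite mxE.
apply: ccont_sum => l; apply: ccont_mul; [exact: ccont_hmx|exact: ccont_cst].
Qed.

(** The other factors contribute traces equal to 1. The factors of a product state are thus
    polynomial functions of the state itself. *)
Lemma marginal_tensor (X : H) (p : forall I, 'M[C]_(d I)) :
  (forall I, \tr (p I) = 1) -> hmx X = tensor_mx p -> marginal X = p.
Proof.
move=> p1 Xp; apply: functional_extensionality_dep => I.
apply/matrixP => i j; rewrite mxE Xp tensor_mxM mxtrace_tensor (bigD1 I) //=.
rewrite dfwithin big1 ?mulr1 => [|J JI]; last first.
  by rewrite dfwithout 1?eq_sym // mulmx1 p1.
rewrite mxtrace_mulC /mxtrace (bigD1 j) //= big1 ?addr0 => [|k kj].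
  rewrite mxE (bigD1 i) //= big1 ?addr0 => [|k ki]; first by rewrite !mxE !eqxx mul1r.
  by rewrite mxE (negbTE ki) andbF mul0r.
by rewrite mxE big1 // => l _; rewrite mxE (negbTE kj) mul0r.
Qed.

(** A product state is characterized by equations between continuous functions of X: the marginals
    are self-adjoint, idempotent and of trace 1, and X is their tensor product. *)
Lemma product_states_closed : closed P.
Proof.
(* Tagged pairs of indices gather into one family the equations for factors of different
   dimensions. *)
pose A := [set X : H | forall t : {I : 'I_N & ('I_(d I) * 'I_(d I))%type},
  marginal X (tag t) (tagged t).1 (tagged t).2 =
  Num.conj (marginal X (tag t) (tagged t).2 (tagged t).1)].
pose B := [set X : H | forall t : {I : 'I_N & ('I_(d I) * 'I_(d I))%type},
  \sum_k marginal X (tag t) (tagged t).1 k * marginal X (tag t) k (tagged t).2 =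
  marginal X (tag t) (tagged t).1 (tagged t).2].
pose E := [set X : H | forall I, \sum_i marginal X I i i = 1].
pose F := [set X : H | forall kl : 'I_n * 'I_n, hmx X kl.1 kl.2 =
  \prod_(I < N) marginal X I ((enum_val kl.1 : multi_index d) I)
                             ((enum_val kl.2 : multi_index d) I)].
have -> : P = A `&` B `&` E `&` F.
  apply/seteqP; split=> [X [p [hp Xp]]|X [[[XA XB] XE] XF]].
    have mX : marginal X = p.
      by apply: marginal_tensor => // I; rewrite rank_one_trace.
    split; [split; [split|]|].
    - move=> [I [i j]] /=; rewrite mX; have [hI _ _] := hp I.
      by move: hI; rewrite hermsymmxE => /eqP {1}->; rewrite !mxE.
    - move=> [I [i j]] /=; rewrite mX; have [_ pp _] := hp I.
      by rewrite -[in RHS]pp mxE.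
    - by move=> I; rewrite mX -[LHS]/(\tr (p I)) rank_one_trace.
    - by move=> [k l] /=; rewrite mX Xp mxE.
  exists (marginal X); split=> [I|].
    apply: rank_one_projectorP.
    - rewrite hermsymmxE; apply/eqP/matrixP => i j; rewrite [RHS]mxE [in RHS]mxE.
      exact: (XA (Tagged (fun I => ('I_(d I) * 'I_(d I))%type) (i, j))).
    - apply/matrixP => i j; rewrite mxE.
      exact: (XB (Tagged (fun I => ('I_(d I) * 'I_(d I))%type) (i, j))).
    - exact: XE.
  by apply/matrixP => k l; rewrite [RHS]mxE (XF (k, l)).
apply: closedI; [apply: closedI; [apply: closedI|]|]; apply: closed_czeros => t.
- exact: ccont_marginal.
- exact/ccont_conj/ccont_marginal.
- by apply: ccont_sum => k; apply: ccont_mul; exact: ccont_marginal.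
- exact: ccont_marginal.
- by apply: ccont_sum => k; exact: ccont_marginal.
- exact: ccont_cst.
- exact: ccont_hmx.
- by apply: ccont_prod => k; exact: ccont_marginal.
Qed.

Lemma product_states_compact : compact P.
Proof.
apply: herm_compact; last exact: product_states_closed.
exists 1; split=> // M M1 X PX; apply: le_trans (ltW M1).
by have /eqP := product_states_norm PX; rewrite eq_le => /andP[].
Qed.

End ProductStatesClosed.

(** * Integration and full support *)

Section Integration.
Context {R : realType} {n : nat}.
Local Notation H := (herm R n).
Context (K : set H) (sigma : probability (borel_herm R n) R).
Implicit Types f g : H -> R.

Definition mean (f : H -> R) : R := \int[sigma]_(p in K) f p.

(** Expressed by integrals of continuous functions rather than by open sets: this is the form
    applied to variances and to positive parts. *)
Definition full_support : Prop := forall f : H -> R, continuous f ->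
  (forall p, K p -> 0 <= f p) -> mean f = 0 -> forall p, K p -> f p = 0.

Lemma borel_open (A : set H) : open A -> measurable (A : set (borel_herm R n)).
Proof. exact: sub_sigma_algebra. Qed.

Lemma borel_closed (A : set H) : closed A -> measurable (A : set (borel_herm R n)).
Proof.
by move=> /closed_openC oA; rewrite -[A]setCK; apply: measurableC; exact: borel_open.
Qed.

Lemma continuous_borel (f : H -> R) (D : set H) : continuous f ->
  measurable_fun (D : set (borel_herm R n)) (f : borel_herm R n -> R).
Proof.
move=> cf; apply: (@measurable_funTS _ _ (borel_herm R n)).
apply: (measurability _ (RGenOpens.measurableE R)).
move=> _ [B [a [b ->]] <-]; rewrite setTI; apply: borel_open.
by apply: open_comp => [x _|]; [exact: cf|exact: interval_open].
Qed.

Hypothesis Kclosed : closed K.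
Hypothesis Knorm : forall p, K p -> `|p| <= 1.
Hypothesis K1 : sigma K = 1%E.

Lemma K_compact : compact K.
Proof.
apply: herm_compact Kclosed; exists 1; split=> // M M1 X KX.
exact: le_trans (Knorm KX) (ltW M1).
Qed.

Lemma K_measurable : measurable (K : set (borel_herm R n)).
Proof. exact: borel_closed. Qed.
Local Hint Resolve K_measurable : core.

Lemma K_nonempty : exists p, K p.
Proof.
apply: contrapT => h; have K0 : K = set0.
  by rewrite -subset0 => p Kp; apply: h; exists p.
by move: K1; rewrite K0 measure0 => /eqP; rewrite eq_sym onee_eq0.
Qed.

Lemma cont_integrable (f : H -> R) : continuous f ->
  sigma.-integrable (K : set (borel_herm R n)) (EFin \o f).
Proof.
move=> cf; apply: measurable_bounded_integrable => //.
- by rewrite [X in (X < _)%E]K1 ltry.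
- exact: continuous_borel.
have [M [_ hM]] : bounded_set (f @` K).
  by apply: compact_bounded; apply: continuous_compact K_compact; exact: continuous_subspaceT.
exists (M + 1); split; first exact: num_real.
move=> x Mx p Kp /=; apply: le_trans (ltW Mx).
have MM : M < M + 1 by rewrite ltrDl.
by apply: (hM _ MM); exists p.
Qed.

Lemma meanD f g : continuous f -> continuous g ->
  mean (fun p => f p + g p) = mean f + mean g.
Proof. by move=> cf cg; apply: RintegralD => //; exact: cont_integrable. Qed.

Lemma meanZ a f : continuous f -> mean (fun p => a * f p) = a * mean f.
Proof. by move=> cf; apply: RintegralZl => //; exact: cont_integrable. Qed.

Lemma meanB f g : continuous f -> continuous g ->
  mean (fun p => f p - g p) = mean f - mean g.
Proof. by move=> cf cg; apply: RintegralB => //; exact: cont_integrable. Qed.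

Lemma mean_cst a : mean (fun=> a) = a.
Proof.
rewrite /mean Rintegral_cst //; rewrite -[RHS]mulr1; congr (_ * _).
exact: (congr1 fine K1).
Qed.

Lemma eq_mean f g : (forall p, K p -> f p = g p) -> mean f = mean g.
Proof. by move=> fg; apply: eq_Rintegral => p; rewrite inE; exact: fg. Qed.

Lemma le_mean f g : continuous f -> continuous g ->
  (forall p, K p -> f p <= g p) -> mean f <= mean g.
Proof.
move=> cf cg.
exact: (le_Rintegral K_measurable (cont_integrable cf) (cont_integrable cg)).
Qed.

Lemma mean_sum (I : Type) (s : seq I) (f : I -> H -> R) :
  (forall i, continuous (f i)) ->
  mean (fun p => \sum_(i <- s) f i p) = \sum_(i <- s) mean (f i).
Proof.
move=> cf; elim: s => [|i s IH].
  rewrite big_nil -[RHS](mean_cst 0); apply: eq_mean => p _; exact: big_nil.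
rewrite big_cons -IH -meanD //; last exact: (@cont_sum R H R^o).
by apply: eq_mean => p _; exact: big_cons.
Qed.

(** On [K] the function equals its absolute value, and a vanishing integral of an absolute value
    forces vanishing almost everywhere. *)
Lemma mean_eq0_null f : continuous f -> (forall p, K p -> 0 <= f p) ->
  mean f = 0 -> sigma [set p | K p /\ f p != 0] = 0%E.
Proof.
move=> cf f0 mf0.
have cf' := cont_integrable cf.
have If0 : (\int[sigma]_(p in (K : set (borel_herm R n))) `| (EFin \o f) p| = 0)%E.
  transitivity (\int[sigma]_(p in (K : set (borel_herm R n))) (EFin \o f) p)%E.
    by apply: eq_integral => p; rewrite inE => Kp; rewrite /= ger0_norm ?f0.
  by rewrite -(fineK (integrable_fin_num _ cf')) // [fine _]mf0.
have mf := measurable_int sigma cf'.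
have /(ae_eq_integral_abs sigma K_measurable mf) [B [mB B0 hB]] := If0.
apply: (@subset_measure0 _ _ _ sigma) B0 => //.
  have -> : [set p | K p /\ f p != 0] = K `&` (f @^-1` [set~ 0]).
    by apply/seteqP; split => p /= [Kp /eqP].
  apply: measurableI => //; apply: borel_open; apply: open_comp => [x _|]; first exact: cf.
  by apply: closed_openC; exact: closed_eq.
move=> p [Kp fp]; apply: hB => /= /(_ Kp) [fp0].
by rewrite fp0 eqxx in fp.
Qed.

End Integration.


(** * Full support of the invariant measure *)

Section ProductFullSupport.
Context {R : realType} {N : nat} {d : 'I_N -> nat}.
Local Notation C := R[i].
Local Notation n := (tensor_dim d).
Local Notation H := (herm R n).
Local Notation P := (product_states R d).
Context (sigma : probability (borel_herm R n) R).
Hypothesis sigma_supp : sigma P = 1%E.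
Hypothesis sigma_inv : locally_invariant sigma.

Lemma product_states_le1 (p : H) : P p -> `|p| <= 1.
Proof. by move=> Pp; have /eqP := product_states_norm Pp; rewrite eq_le => /andP[]. Qed.

(* The translates by local unitaries of a null open set meeting P cover the
   compact set P, and are null. *)
Lemma product_states_full_support : full_support P sigma.
Proof.
move=> f cf f0 mf p1 Pp1; apply/eqP; apply: contrapT => /negP fp1.
have Pm : measurable (P : set (borel_herm R n)).
  exact: (@borel_closed R n P product_states_closed).
pose O : set H := f @^-1` [set~ 0].
have oO : open O.
  by apply: open_comp => [x _|]; [exact: cf|apply: closed_openC; exact: closed_eq].
(* [O] lies in the union of the null subset of [P] where [f] is nonzero and of the complement of
   [P], null because [P] has full measure. *)
have O0 : sigma O = 0%E.
  apply: (@subset_measure0 _ _ _ sigma _ ([set p | P p /\ f p != 0] `|` ~` P)).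
  - exact: borel_open.
  - apply: measurableU; last exact: measurableC.
    have -> : [set p | P p /\ f p != 0] = P `&` O.
      by apply/seteqP; split => p /= [Pp /eqP].
    by apply: measurableI => //; exact: borel_open.
  - move=> p Op; have [Pp|nPp] := pselect (P p); [left|by right].
    by split=> //; apply/eqP.
  apply/null_set_setU.
  - have -> : [set p | P p /\ f p != 0] = P `&` O.
      by apply/seteqP; split => p /= [Pp /eqP].
    by apply: measurableI => //; exact: borel_open.
  - exact: measurableC.
  - exact: (mean_eq0_null product_states_closed product_states_le1 sigma_supp).
  - apply: (etrans (probability_setC sigma Pm)).
    by rewrite [X in (_ - X)%E]sigma_supp subee.
(* Choice requires a value at every operator; the zero family is a default outside [P]. *)
have /choice[U hU] : forall p : H, exists U : forall I, 'M[C]_(d I), P p ->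
    (forall I, U I \is unitarymx) /\ conj_herm (tensor_mx U) p = p1.
  move=> p; have [Pp|nPp] := pselect (P p); last by exists (fun=> 0).
  by have [U hU] := product_states_transitive Pp Pp1; exists U.
(* [F p] contains [p], since the chosen unitary sends [p] to [p1], a point of [O]. *)
pose F (p : H) : set H := conj_herm (tensor_mx (U p)) @^-1` O.
have oF p : P p -> open (F p).
  move=> /hU[Up _]; apply: open_comp => // x _.
  exact/conj_herm_continuous/tensor_mx_unitary.
have F0 p : P p -> sigma.-negligible (F p : set (borel_herm R n)).
  move=> Pp; have mF : measurable (F p : set (borel_herm R n)).
    by apply: borel_open; exact: oF.
  have mO : measurable (O : set (borel_herm R n)) by exact: borel_open.
  exists (F p); split=> //.
  exact: (etrans (sigma_inv (hU _ Pp).1 mO) O0).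
have : cover_compact P by rewrite -compact_cover; exact: product_states_compact.
move=> /(_ H P F oF) [|D DP PD].
  by move=> p Pp; exists p => //; rewrite /F /O /=; have [_ ->] := hU _ Pp; exact/eqP.
have sn (s : seq H) : {subset s <= P} ->
    sigma.-negligible ([set p | exists2 q, q \in s & F q p] : set (borel_herm R n)).
  elim: s => [|q s IH] sP.
    have -> : [set p | exists2 q, q \in [::] & F q p] = set0.
      by apply/seteqP; split=> // p [].
    exact: negligible_set0.
  have Pq : P q by have := sP q; rewrite in_cons eqxx => /(_ isT)/set_mem.
  have sP' : {subset s <= P} by move=> r rs; apply: sP; rewrite inE rs orbT.
  apply: negligibleS (negligibleU (F0 _ Pq) (IH sP')).
  by move=> p [r]; rewrite in_cons => /orP[/eqP ->|rs] Fp; [left|right; exists r].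
have : sigma.-negligible (P : set (borel_herm R n)).
  have DP' : {subset enum_fset D <= P} by move=> p; exact: DP.
  apply: negligibleS (sn _ DP').
  by move=> p /PD[q qD Fq]; exists q.
move=> /(measure_negligible Pm) P0; have /eqP := sigma_supp.
by rewrite [X in X == _]P0 eq_sym onee_eq0.
Qed.

End ProductFullSupport.

(** * The log-partition function *)

Section Frechet.
Context {R : realType} {V W : normedModType R}.

Lemma frechet_is_diff (f : V -> W) (L : {linear V -> W}) x : continuous L ->
  (forall e, 0 < e -> exists2 r, 0 < r &
    forall h, `|h| < r -> `|f (x + h) - f x - L h| <= e * `|h|) ->
  is_diff x f L.
Proof.
move=> cL fL.
have fo : f \o shift x = cst (f x) + L +o_ 0 id.
  apply/eqaddoP => _/posnumP[e]; have [r r0 hr] := fL e%:num [gt0 of e%:num].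
  apply/nbhs_normP; exists r => //= h /=; rewrite sub0r normrN => hr'.
  have := hr h hr'; rewrite !fctE /= opprD addrA.
  by rewrite [h + x]addrC.
have dE := diff_unique cL fo.
by split=> //; apply/diff_locallyP; rewrite dE; split.
Qed.

Lemma diff_frechet (f : V -> W) x : differentiable f x ->
  forall e, 0 < e -> exists2 r, 0 < r &
    forall h, `|h| < r -> `|f (x + h) - f x - 'd f x h| <= e * `|h|.
Proof.
move=> /diff_locally fo e e0.
move/eqaddoP: fo => /(_ e e0) /nbhs_normP[r r0 hr]; exists r => // h hr'.
have := hr h; rewrite /= sub0r normrN => /(_ hr').
by rewrite !fctE /= opprD addrA [h + x]addrC.
Qed.

End Frechet.

Section Gradient.
Context {R : realType} {n : nat}.
Local Notation H := (herm R n).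

Lemma hip_inj (X Y : H) : (forall v, hip X v = hip Y v) -> X = Y.
Proof.
by move=> XY; apply/eqP; rewrite -subr_eq0; apply/eqP/hip_eq0; rewrite hipBl XY subrr.
Qed.

(** The vector representing the differential is unique because the inner product is definite, so
    [get] can only return G. *)
Lemma gradient_eq (f : H -> R) X G : is_diff X f (hip G) -> gradient f X = G.
Proof.
move=> df; have dE : 'd f X = hip G :> (H -> R) by exact: diff_val.
apply: hip_inj => v; rewrite -dE.
have := @getPex _ [set G' | forall Y, 'd f X Y = hip G' Y].
by rewrite -/(gradient f X) => ->//; exists G => Y; rewrite dE.
Qed.

Lemma is_diff_derive (f : H -> R) X G : is_diff X f (hip G) ->
  forall v, 'D_v f X = hip G v.
Proof. by move=> df v; rewrite deriveE // diff_val. Qed.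

End Gradient.

(** Everything follows from 1 + x <= e^x at s and at -s: the second gives e^s - 1 <= s e^s, hence
    e^s - 1 - s <= s (e^s - 1), which is then bounded according to the sign of s. *)
Lemma expR_quadratic {R : realType} (s : R) :
  `|expR s - 1 - s| <= s ^+ 2 * expR `|s|.
Proof.
have h1 := expR_ge1Dx s; have h2 := expR_ge1Dx (- s).
have e0 := expR_gt0 s.
have h3 : expR s * (1 - s) <= 1.
  by have := ler_wpM2l (ltW e0) h2; rewrite expRxMexpNx_1.
rewrite ger0_norm; last by lra.
have [s0|s0] := leP 0 s; first by rewrite ger0_norm //; nra.
rewrite ltr0_norm //; have h4 : 1 <= expR (- s) by lra.
nra.
Qed.

(** * Weighted partition functions and their differentials *)

Section Zeta.
Context {R : realType} {n : nat}.
Local Notation H := (herm R n).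
Context (K : set H) (sigma : probability (borel_herm R n) R).
Implicit Types (q f g : H -> R) (X Y v h : H).
Hypothesis Kclosed : closed K.
Hypothesis Knorm : forall p, K p -> `|p| <= 1.
Hypothesis K1 : sigma K = 1%E.
Local Notation mean := (mean K sigma).

(** The weight [q] makes the family stable under differentiation: a derivative along v only
    multiplies the weight by <v, p>. *)
Definition zeta q X : R := mean (fun p => expR (hip X p) * q p).

Lemma exp_hip_continuous X : continuous (fun p : H => expR (hip X p)).
Proof.
apply: (@cont_comp R H R^o _ (hip X) expR); first exact: hip_continuous.
exact: continuous_expR.
Qed.

Lemma zeta_integrand_continuous q X : continuous q ->
  continuous (fun p : H => expR (hip X p) * q p).
Proof. by move=> cq; apply: cont_mul => //; exact: exp_hip_continuous. Qed.

Lemma continuous_bounded q : continuous q ->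
  exists2 M, 0 <= M & forall p, K p -> `|q p| <= M.
Proof.
move=> cq; have [M [_ hM]] : bounded_set (q @` K).
  apply: compact_bounded; apply: continuous_compact (K_compact Kclosed Knorm).
  exact: continuous_subspaceT.
have MM : M < `|M| + 1 by rewrite (le_lt_trans (ler_norm _)) // ltrDl.
by exists (`|M| + 1) => [|p Kp]; [exact: addr_ge0|apply: (hM _ MM); exists p].
Qed.

Lemma norm_mean_le f c : continuous f -> (forall p, K p -> `|f p| <= c) ->
  `|mean f| <= c.
Proof.
move=> cf fc; have cc (a : R) : continuous (fun _ : H => a) by exact: (@cont_cst R H R^o).
rewrite ler_norml -{1}(mean_cst Kclosed K1 (- c)) -[X in _ && (_ <= X)](mean_cst Kclosed K1).
apply/andP; split; apply: (le_mean Kclosed Knorm K1) => // p Kp.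
  by have := fc p Kp; rewrite ler_norml => /andP[].
exact: le_trans (ler_norm _) (fc p Kp).
Qed.

Lemma hip_le_normK X p : K p -> `|hip X p| <= `|X|.
Proof.
move=> Kp; apply: le_trans (hip_ler_norm _ _) _.
by rewrite -[leRHS]mulr1 ler_wpM2l // Knorm.
Qed.

(** This takes the place of differentiation under the integral sign: the integrand's remainder is
    q(p) e^<X, p> (e^<h, p> - 1 - <h, p>), bounded uniformly on [K] by [expR_quadratic]. *)
Lemma zeta_expansion q : continuous q -> exists2 M, 0 <= M & forall X h,
  `|zeta q (X + h) - zeta q X - zeta (fun p => hip h p * q p) X| <=
  M * expR `|X| * expR `|h| * `|h| ^+ 2.
Proof.
move=> cq; have [M M0 qM] := continuous_bounded cq; exists M => // X h.
have chq : continuous (fun p : H => hip h p * q p).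
  by apply: cont_mul => //; exact: hip_continuous.
have ci Y q' : continuous q' -> continuous (fun p : H => expR (hip Y p) * q' p).
  exact: zeta_integrand_continuous.
have cd : continuous (fun p : H => expR (hip (X + h) p) * q p - expR (hip X p) * q p).
  by apply: (@cont_sub R H R^o); exact: ci.
rewrite /zeta -(meanB Kclosed Knorm K1); [|exact: ci..].
rewrite -(meanB Kclosed Knorm K1) //; last exact: ci.
apply: norm_mean_le; first by apply: (@cont_sub R H R^o) => //; exact: ci.
move=> p Kp; have -> : expR (hip (X + h) p) * q p - expR (hip X p) * q p -
    expR (hip X p) * (hip h p * q p) =
    q p * expR (hip X p) * (expR (hip h p) - 1 - hip h p).
  rewrite hipDl expRD.
  by move: (q p) (hip h p) (expR (hip h p)) (expR (hip X p)) => a b c e; ring.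
have hp := hip_le_normK h Kp; have Xp := hip_le_normK X Kp.
have e1 : expR (hip X p) <= expR `|X| by rewrite ler_expR (le_trans (ler_norm _)).
have e2 : `|expR (hip h p) - 1 - hip h p| <= expR `|h| * `|h| ^+ 2.
  apply: le_trans (expR_quadratic _) _.
  rewrite [leRHS]mulrC ler_pM ?expR_ge0 ?sqr_ge0 ?ler_expR //.
  by rewrite -[hip _ _ ^+ 2]real_normK ?num_real // ler_pXn2r ?nnegrE.
rewrite !normrM -mulrA -[leRHS]mulrA -[leRHS]mulrA.
apply: ler_pM; rewrite ?mulr_ge0 ?qM //; apply: ler_pM => //.
by rewrite ger0_norm // expR_ge0.
Qed.

Lemma zeta_sum (I : Type) (s : seq I) (q : I -> H -> R) X :
  (forall i, continuous (q i)) ->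
  zeta (fun p => \sum_(i <- s) q i p) X = \sum_(i <- s) zeta (q i) X.
Proof.
move=> cq; rewrite /zeta -(mean_sum Kclosed Knorm K1) //; last first.
  by move=> i; exact: zeta_integrand_continuous.
by apply: eq_mean => p _; rewrite mulr_sumr.
Qed.

Lemma zetaZ a q X : continuous q -> zeta (fun p => a * q p) X = a * zeta q X.
Proof.
move=> cq; rewrite /zeta -(meanZ Kclosed Knorm K1) //; last exact: zeta_integrand_continuous.
by apply: eq_mean => p _; ring.
Qed.

(** The vector integral of e^<X, p> q(p) p, assembled from its coordinates so that only real
    integrals occur. *)
Definition zeta_grad q X : H := \sum_k zeta (fun p => hip (hbasis k) p * q p) X *: hbasis k.

Lemma hip_zeta_grad q X v : continuous q ->
  hip (zeta_grad q X) v = zeta (fun p => hip v p * q p) X.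
Proof.
move=> cq; have ch w : continuous (fun p : H => hip w p * q p).
  by apply: cont_mul => //; exact: hip_continuous.
have -> : (fun p => hip v p * q p) =
    (fun p => \sum_k hip v (hbasis k) * (hip (hbasis k) p * q p)).
  apply/funext => p; rewrite (hip_sum v p) mulr_suml; apply: eq_bigr => k _.
  by rewrite (hipC p) mulrA.
rewrite zeta_sum; last by move=> k; apply: cont_mul => //; exact: (@cont_cst R H R^o).
rewrite hipC hip_sumr; apply: eq_bigr => k _.
by rewrite zetaZ // hipZr mulrC.
Qed.

Lemma zeta_is_diff q X : continuous q -> is_diff X (zeta q) (hip (zeta_grad q X)).
Proof.
move=> cq; have [M M0 hM] := zeta_expansion cq.
apply: frechet_is_diff => [|e e0]; first exact: hip_continuous.
(* For |h| < 1 the remainder is at most [M'] |h|^2; the added 1 makes [M'] positive. *)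
pose M' := M * expR `|X| * expR 1 + 1.
have M'0 : 0 < M' by rewrite ltr_wpDl // !mulr_ge0 ?expR_ge0.
exists (Num.min 1 (e / M')) => [|h].
  by rewrite lt_min ltr01 divr_gt0.
rewrite lt_min => /andP[h1 he]; rewrite /= hip_zeta_grad //.
apply: le_trans (hM X h) _; rewrite expr2 mulrA; apply: ler_wpM2r => //.
rewrite ltr_pdivlMr // in he; apply: le_trans (ltW he); rewrite mulrC.
apply: ler_wpM2l => //; apply: (@le_trans _ _ (M * expR `|X| * expR 1)); last by rewrite lerDl.
apply: ler_wpM2l; first by rewrite mulr_ge0 ?expR_ge0.
by rewrite ler_expR ltW.
Qed.

Definition Zfun X : R := mean (fun p => expR (hip X p)).

Lemma ZfunE X : Zfun X = zeta (fun=> 1) X.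
Proof. by apply: eq_mean => p _; rewrite mulr1. Qed.

Lemma Zfun_gt0 X : 0 < Zfun X.
Proof.
apply: (@lt_le_trans _ _ (expR (- `|X|))); first exact: expR_gt0.
rewrite -[leLHS](mean_cst Kclosed K1); apply: (le_mean Kclosed Knorm K1) => //.
- exact: (@cont_cst R H R^o).
- exact: exp_hip_continuous.
- move=> p Kp; rewrite ler_expR; have := hip_le_normK X Kp.
  by rewrite ler_norml => /andP[].
Qed.

(* The coordinates of chi and of its inverse differential lie in this class, which
   is closed under directional derivatives: every smoothness claim is then an
   induction on the order of differentiation. *)
Inductive smooth_alg : (H -> R) -> Prop :=
| sa_zeta q : continuous q -> smooth_alg (zeta q)
| sa_hip v : smooth_alg (hip v)
| sa_cst c : smooth_alg (fun=> c)
| sa_add f g : smooth_alg f -> smooth_alg g -> smooth_alg (fun X => f X + g X)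
| sa_mul f g : smooth_alg f -> smooth_alg g -> smooth_alg (fun X => f X * g X)
| sa_inv f : smooth_alg f -> (forall X, f X != 0) -> smooth_alg (fun X => (f X)^-1).

Lemma sa_diff f : smooth_alg f -> forall X, differentiable f X.
Proof.
elim=> [q cq X|v X|c X|{}f g _ df _ dg X|{}f g _ df _ dg X|{}f _ df f0 X].
- by have := zeta_is_diff X cq; move=> [].
- by apply: linear_differentiable; exact: hip_continuous.
- exact: differentiable_cst.
- exact: differentiableD.
- exact: differentiableM.
- exact: differentiableV.
Qed.

Lemma sa_derivable f : smooth_alg f -> forall X v, derivable f X v.
Proof. by move=> hf X v; apply/diff_derivable/sa_diff. Qed.

Lemma sa_continuous f : smooth_alg f -> continuous f.
Proof. by move=> hf X; apply/differentiable_continuous/sa_diff. Qed.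

Lemma zeta_derive q X v : continuous q ->
  'D_v (zeta q) X = zeta (fun p => hip v p * q p) X.
Proof.
by move=> cq; rewrite (is_diff_derive (zeta_is_diff X cq)) hip_zeta_grad.
Qed.

Lemma hip_derive w X v : 'D_v (hip w) X = hip w v.
Proof.
have dh : differentiable (hip w) X.
  by apply: linear_differentiable; exact: hip_continuous.
by rewrite deriveE // diff_lin //; exact: hip_continuous.
Qed.

Lemma sa_derive f : smooth_alg f -> forall v, smooth_alg (fun X => 'D_v f X).
Proof.
elim=> [q cq v|w v|c v|{}f g hf df hg dg v|{}f g hf df hg dg v|{}f hf df f0 v].
- under eq_fun do rewrite zeta_derive //.
  by apply: sa_zeta; apply: cont_mul => //; exact: hip_continuous.
- by under eq_fun do rewrite hip_derive; exact: sa_cst.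
- by under eq_fun do rewrite derive_cst; exact: sa_cst.
- rewrite (_ : (fun X => _) = (fun X => 'D_v f X + 'D_v g X)).
    by apply: sa_add.
  by apply/funext => X; rewrite -deriveD //; exact: sa_derivable.
- rewrite (_ : (fun X => _) = (fun X => f X * 'D_v g X + g X * 'D_v f X)).
    by apply: sa_add; apply: sa_mul.
  by apply/funext => X; rewrite deriveM //; exact: sa_derivable.
- rewrite (_ : (fun X => _) = (fun X => (-1) * ((f X)^-1 * (f X)^-1) * 'D_v f X)).
    apply: sa_mul => //; apply: sa_mul; first exact: sa_cst.
    by apply: sa_mul; exact: sa_inv.
  apply/funext => X; rewrite deriveV //; last exact: sa_derivable.
  by rewrite mulN1r -exprVn expr2.
Qed.

Lemma sa_sum (I : Type) (s : seq I) (f : I -> H -> R) :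
  (forall i, smooth_alg (f i)) -> smooth_alg (fun X => \sum_(i <- s) f i X).
Proof.
move=> hf; elim: s => [|i s IH].
  by under eq_fun do rewrite big_nil; exact: sa_cst.
by under eq_fun do rewrite big_cons; exact: sa_add.
Qed.

Lemma sa_prod (I : Type) (s : seq I) (f : I -> H -> R) :
  (forall i, smooth_alg (f i)) -> smooth_alg (fun X => \prod_(i <- s) f i X).
Proof.
move=> hf; elim: s => [|i s IH].
  by under eq_fun do rewrite big_nil; exact: sa_cst.
by under eq_fun do rewrite big_cons; exact: sa_mul.
Qed.

Lemma sa_det m (A : H -> 'M[R]_m) :
  (forall i j, smooth_alg (fun X => A X i j)) -> smooth_alg (fun X => \det (A X)).
Proof.
move=> hA; apply: sa_sum => s; apply: sa_mul; first exact: sa_cst.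
exact: sa_prod.
Qed.

Lemma sa_Zfun : smooth_alg Zfun.
Proof. by rewrite (funext ZfunE); apply: sa_zeta; exact: (@cont_cst R H R^o). Qed.

Lemma sa_invZ : smooth_alg (fun X => (Zfun X)^-1).
Proof. by apply: sa_inv sa_Zfun _ => X; rewrite gt_eqF ?Zfun_gt0. Qed.

Definition Wfun X : R := ln (Zfun X).

(** The mean of the measure proportional to e^<X, p>, given by an explicit formula; [Wfun_is_diff]
    makes it the gradient of [Wfun]. *)
Definition chifun X : H := \sum_k ((Zfun X)^-1 * zeta (hip (hbasis k)) X) *: hbasis k.

Lemma hip_chifun X v : hip (chifun X) v = (Zfun X)^-1 * zeta (hip v) X.
Proof.
have -> : chifun X = (Zfun X)^-1 *: zeta_grad (fun=> 1) X.
  rewrite scaler_sumr; apply: eq_bigr => k _; rewrite scalerA; congr (_ * _ *: _).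
  by congr zeta; apply/funext => p; rewrite mulr1.
rewrite hipZl hip_zeta_grad; last exact: (@cont_cst R H R^o).
by congr (_ * zeta _ _); apply/funext => p; rewrite mulr1.
Qed.

Lemma Wfun_is_diff X : is_diff X Wfun (hip (chifun X)).
Proof.
have Z0 := Zfun_gt0 X.
have dZ : is_diff X Zfun (hip (zeta_grad (fun=> 1) X)).
  by rewrite (funext ZfunE); apply: zeta_is_diff; exact: (@cont_cst R H R^o).
have [dl dlE] := is_derive1_ln Z0.
have dZ' : differentiable Zfun X by case: dZ.
have dl' : differentiable (@ln R) (Zfun X) by apply/derivable1_diffP.
split; first exact: (differentiable_comp dZ' dl').
rewrite (diff_comp dZ' dl'); apply/funext => v /=.
rewrite deriv1E // derive1E dlE diff_val /= /GRing.scale /= mulrC hip_zeta_grad; last first.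
  exact: (@cont_cst R H R^o).
rewrite hip_chifun; congr (_ * zeta _ _).
by apply/funext => p; rewrite mulr1.
Qed.

Lemma sa_hip_chifun v : smooth_alg (fun X => hip (chifun X) v).
Proof.
under eq_fun do rewrite hip_chifun.
by apply: sa_mul; [exact: sa_invZ|apply: sa_zeta; exact: hip_continuous].
Qed.

End Zeta.

(** * Strict convexity and surjectivity *)

Section LineDerivative.
Context {R : realType} {V W : normedModType R}.

(** Restriction to a line gives functions of one real variable, to which the mean value theorem and
    the criterion for minima apply. *)
Lemma is_derive_line (f : V -> W) X u (t : R) : derivable f (X + t *: u) u ->
  is_derive t 1 (fun s : R => f (X + s *: u)) ('D_u f (X + t *: u)).
Proof.
have E : (fun h : R => h^-1 *: (((fun s : R => f (X + s *: u)) \o shift t) (h *: 1) -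
      f (X + t *: u))) =
    (fun h : R => h^-1 *: ((f \o shift (X + t *: u)) (h *: u) - f (X + t *: u))).
  apply/funext => h /=; congr (_ *: (f _ - _)).
  by rewrite [h *: 1]mulr1 scalerDl addrCA.
by move=> df; split; rewrite /derivable /derive E.
Qed.

End LineDerivative.

Lemma max0_lipschitz {R : realType} (a b : R) :
  `|Num.max a 0 - Num.max b 0| <= `|a - b|.
Proof.
wlog ab : a b / a <= b.
  by move=> h; have [/h//|/ltW/h] := leP a b; rewrite distrC (distrC b).
rewrite [leRHS]ler0_norm ?subr_le0 // opprB ler_norml.
rewrite !maxEle; case: (leP a 0) => a0; case: (leP b 0) => b0; apply/andP; split; lra.
Qed.

Section SphereMin.
Context {R : realType} {n : nat}.
Local Notation H := (herm R n).

Lemma continuous_normh : continuous (fun u : H => `|u|).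
Proof. exact: norm_continuous. Qed.

Lemma traceless_ball_compact (r : R) :
  compact [set u : H | hip hone u = 0 /\ `|u| <= r].
Proof.
apply: herm_compact.
  exists r; split; first exact: num_real.
  by move=> M rM u [_ ur]; apply: le_trans ur (ltW rM).
have -> : [set u : H | hip hone u = 0 /\ `|u| <= r] =
    (hip hone @^-1` [set 0]) `&` ((fun u : H => `|u|) @^-1` [set x | x <= r]).
  by apply/seteqP; split.
apply: closedI; apply: preimage_closed.
- by move=> x _; exact: hip_continuous.
- exact: closed_eq.
- by move=> x _; exact: continuous_normh.
- exact: closed_le.
Qed.

Lemma traceless_sphere_compact (r : R) :
  compact [set u : H | hip hone u = 0 /\ `|u| = r].
Proof.
apply: (@subclosed_compact _ _ [set u : H | hip hone u = 0 /\ `|u| <= r]).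
- have -> : [set u : H | hip hone u = 0 /\ `|u| = r] =
      (hip hone @^-1` [set 0]) `&` ((fun u : H => `|u|) @^-1` [set r]).
    by apply/seteqP; split.
  apply: closedI; apply: preimage_closed.
  + by move=> x _; exact: hip_continuous.
  + exact: closed_eq.
  + by move=> x _; exact: continuous_normh.
  + exact: closed_eq.
- exact: traceless_ball_compact.
- by move=> u [u0 ur]; split=> //; rewrite [X in X <= _]ur.
Qed.

Lemma traceless_sphere_min (f : H -> R) (r : R) : continuous f ->
  (forall u, hip hone u = 0 -> `|u| = r -> 0 < f u) ->
  exists2 m, 0 < m & forall u, hip hone u = 0 -> `|u| = r -> m <= f u.
Proof.
move=> cf f0.
(* The sphere can be empty, for instance when 0 is the only traceless operator and [r] is positive;
   any positive bound then works. *)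
have [S0|S0] := pselect ([set u : H | hip hone u = 0 /\ `|u| = r] !=set0); last first.
  by exists 1 => // u u0 ur; exfalso; apply: S0; exists u.
have [|c cS hc] := compact_EVT_min (f := f) S0 (@traceless_sphere_compact r).
  exact: continuous_subspaceT.
exists (f c); first by have := set_mem cS => -[]; exact: f0.
by move=> u u0 ur; apply: hc; rewrite inE.
Qed.

End SphereMin.

(** * The covariance form, strict convexity and critical points *)

Section Convexity.
Context {R : realType} {n : nat}.
Local Notation H := (herm R n).
Context (K : set H) (sigma : probability (borel_herm R n) R).
Implicit Types (q f g : H -> R) (X Y u v h y : H).
Hypothesis Kclosed : closed K.
Hypothesis Knorm : forall p, K p -> `|p| <= 1.
Hypothesis K1 : sigma K = 1%E.
Hypothesis Ktrace : forall p, K p -> hip hone p = 1.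
Hypothesis Kfull : full_support K sigma.
Hypothesis Ksep : forall Y, (forall p, K p -> hip Y p = 0) -> Y = 0.
Local Notation mean := (mean K sigma).
Local Notation zeta := (zeta K sigma).
Local Notation Zfun := (Zfun K sigma).
Local Notation Wfun := (Wfun K sigma).
Local Notation chi := (chifun K sigma).
Local Notation smooth_alg := (smooth_alg K sigma).
Let Z_gt0 := Zfun_gt0 Kclosed Knorm K1.
Let hip_cont := @hip_continuous R n.
Let sad := sa_derivable Kclosed Knorm K1.
Let hip_chi := hip_chifun Kclosed Knorm K1.

(** The Hessian of [Wfun], taken as a derivative of its gradient; [covE] identifies it with a
    covariance. *)
Definition cov X u v : R := 'D_u (fun Y => hip (chi Y) v) X.

Lemma covE X u v : cov X u v =
  (Zfun X)^-1 * zeta (fun p => hip u p * hip v p) X -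
  (Zfun X)^-1 ^+ 2 * zeta (hip u) X * zeta (hip v) X.
Proof.
have Z0 := lt0r_neq0 (Z_gt0 X).
rewrite /cov (_ : (fun Y => _) = (fun Y => (Zfun Y)^-1 * zeta (hip v) Y)); last first.
  by apply/funext => Y; exact: hip_chi.
rewrite deriveM; [|exact/sad/sa_invZ|by apply: sad; apply: sa_zeta; exact: hip_cont].
rewrite deriveV //; last exact/sad/sa_Zfun.
rewrite (zeta_derive Kclosed Knorm K1 X u (@hip_cont v)).
rewrite (_ : 'D_u Zfun X = zeta (hip u) X); last first.
  rewrite (funext (ZfunE K sigma)) (zeta_derive Kclosed Knorm K1 X u (@cont_cst R H R^o 1)).
  by congr zeta; apply/funext => p; rewrite mulr1.
rewrite /GRing.scale /= -exprVn.
move: (Zfun X)^-1 (zeta (hip u) X) (zeta (hip v) X) (zeta _ X) => z a b c; ring.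
Qed.

Lemma cov_variance X v : let c := (Zfun X)^-1 * zeta (hip v) X in
  cov X v v = (Zfun X)^-1 * mean (fun p => expR (hip X p) * (hip v p - c) ^+ 2).
Proof.
move=> c; have Z0 := lt0r_neq0 (Z_gt0 X).
rewrite covE; set vv := zeta _ X.
have -> : mean (fun p => expR (hip X p) * (hip v p - c) ^+ 2) =
    vv + ((- 2 * c) * zeta (hip v) X + c ^+ 2 * Zfun X).
  have cvv : continuous (fun p : H => expR (hip X p) * (hip v p * hip v p)).
    by apply: cont_mul; [exact: exp_hip_continuous|apply: cont_mul; exact: hip_cont].
  have cv : continuous (fun p : H => expR (hip X p) * hip v p).
    by apply: cont_mul; [exact: exp_hip_continuous|exact: hip_cont].
  have ce := @exp_hip_continuous R n X.
  have czv : continuous (fun p : H => (- 2 * c) * (expR (hip X p) * hip v p)).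
    by apply: cont_mul => //; exact: (@cont_cst R H R^o).
  have cz : continuous (fun p : H => c ^+ 2 * expR (hip X p)).
    by apply: cont_mul => //; exact: (@cont_cst R H R^o).
  rewrite /vv /zeta /Zfun -!(meanZ Kclosed Knorm K1) // -(meanD Kclosed Knorm K1) //.
  rewrite -(meanD Kclosed Knorm K1) //; last exact: (@cont_add R H R^o).
  by apply: eq_mean => p _; ring.
rewrite /c; field.
exact: Z0.
Qed.

Lemma cov_ge0 X v : 0 <= cov X v v.
Proof.
rewrite cov_variance mulr_ge0 //; first by rewrite invr_ge0 ltW // Z_gt0.
by apply: Rintegral_ge0 => p _; rewrite mulr_ge0 ?expR_ge0 ?sqr_ge0.
Qed.

(** A vanishing variance and full support make <v, p> a constant c on [K]. As elements of [K] have
    trace 1, v - c [hone] is orthogonal to all of them, hence zero. *)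
Lemma cov_eq0 X v : cov X v v = 0 -> exists c, v = c *: hone.
Proof.
rewrite cov_variance => /eqP; rewrite mulf_eq0 invr_eq0 gt_eqF ?Z_gt0 //=.
set c := _ * _ => /eqP mc.
have cf : continuous (fun p : H => expR (hip X p) * (hip v p - c) ^+ 2).
  apply: cont_mul; first exact: exp_hip_continuous.
  under eq_fun do rewrite expr2.
  by apply: cont_mul; apply: (@cont_sub R H R^o); [exact: hip_cont|exact: (@cont_cst R H R^o)|
    exact: hip_cont|exact: (@cont_cst R H R^o)].
have f0 p : K p -> 0 <= expR (hip X p) * (hip v p - c) ^+ 2.
  by move=> _; rewrite mulr_ge0 ?expR_ge0 ?sqr_ge0.
exists c; apply/eqP; rewrite -subr_eq0; apply/eqP/Ksep => p Kp.
have /eqP := Kfull cf f0 mc Kp.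
rewrite mulf_eq0 gt_eqF ?expR_gt0 //= sqrf_eq0 => /eqP <-.
by rewrite hipBl hipZl Ktrace // mulr1.
Qed.

(** The square of the trace removes the degenerate direction [hone]; the sum is the quadratic form
    of the differential of [chi_ext]. *)
Lemma cov_gt0 X v : v != 0 -> 0 < cov X v v + hip hone v ^+ 2.
Proof.
move=> v0; rewrite lt_def addr_ge0 ?cov_ge0 ?sqr_ge0 // andbT.
apply: contraNneq v0 => /eqP; rewrite paddr_eq0 ?cov_ge0 ?sqr_ge0 //.
rewrite sqrf_eq0 => /andP[/eqP /cov_eq0[c ->] /eqP].
by move=> c0; apply/eqP/hip_eq0; rewrite hipZl c0 mulr0.
Qed.

Lemma cov_traceless_gt0 X v : v != 0 -> hip hone v = 0 -> 0 < cov X v v.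
Proof. by move=> v0 tv; have := cov_gt0 X v0; rewrite tv expr0n addr0. Qed.

Lemma chi_line_derive X u v (t : R) :
  is_derive t 1 (fun s : R => hip (chi (X + s *: u)) v) (cov (X + t *: u) u v).
Proof. exact/(is_derive_line (f := fun Y => hip (chi Y) v))/sad/sa_hip_chifun. Qed.

Lemma W_line_derive X u (t : R) :
  is_derive t 1 (fun s : R => Wfun (X + s *: u)) (hip (chi (X + t *: u)) u).
Proof.
have dW := Wfun_is_diff Kclosed Knorm K1 (X + t *: u).
rewrite -(is_diff_derive dW); apply: is_derive_line.
by apply: diff_derivable; case: dW.
Qed.

Lemma derive_within_continuous (f df : R -> R) (a b : R) :
  (forall t, is_derive t (1 : R) f (df t)) -> {within `[a, b], continuous f}.
Proof.
move=> fd; apply: continuous_subspaceT => t.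
by apply/differentiable_continuous/derivable1_diffP; case: (fd t).
Qed.

(** Two mean value theorems: the increment of [Wfun] is <chi(X + t u), u> with t > 0, and this
    exceeds <chi X, u> by t times a positive value of the covariance form. *)
Lemma W_strict X u : u != 0 -> hip hone u = 0 ->
  Wfun X + hip (chi X) u < Wfun (X + u).
Proof.
move=> u0 tu.
have [t] := MVT ltr01 (fun t _ => W_line_derive X u t)
  (derive_within_continuous (W_line_derive X u) (a := 0) (b := 1)).
rewrite in_itv /= subr0 mulr1 scale1r scale0r addr0 => /andP[t0 _] WE.
have [s _] := MVT t0 (fun t _ => chi_line_derive X u u t)
  (derive_within_continuous (chi_line_derive X u u) (a := 0) (b := t)).
rewrite subr0 scale0r addr0 => cE.
have : 0 < cov (X + s *: u) u u * t by rewrite mulr_gt0 // cov_traceless_gt0.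
by rewrite -cE subr_gt0 => h; rewrite -ltrBrDl WE.
Qed.

Lemma chi_trace X : hip hone (chi X) = 1.
Proof.
rewrite hipC hip_chi -[RHS](mulVf (lt0r_neq0 (Z_gt0 X))); congr (_ * _).
by apply: eq_mean => p Kp; rewrite Ktrace // mulr1.
Qed.

(** If the gradients agree, the strict inequalities of [W_strict] at X and at Y add up to a
    contradiction. *)
Lemma chi_inj X Y : hip hone (X - Y) = 0 -> chi X = chi Y -> X = Y.
Proof.
move=> tXY cXY; apply/eqP; rewrite -subr_eq0; apply/negPn/negP => u0.
have := @W_strict Y _ u0 tXY; rewrite addrCA subrr addr0 => h1.
have u0' : Y - X != 0 by rewrite -opprB oppr_eq0.
have tYX : hip hone (Y - X) = 0 by rewrite -opprB hipNr tXY oppr0.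
have := @W_strict X _ u0' tYX; rewrite addrCA subrr addr0 => h2.
have e : hip (chi X) (Y - X) = - hip (chi X) (X - Y) by rewrite -hipNr opprB.
rewrite e cXY in h2.
set w := hip (chi Y) (X - Y) in h1 h2; set a := Wfun X in h1 h2; set b := Wfun Y in h1 h2.
by clearbody w a b; lra.
Qed.

Lemma W_continuous : continuous Wfun.
Proof.
by move=> X; apply: differentiable_continuous; case: (Wfun_is_diff Kclosed Knorm K1 X).
Qed.

Lemma cont_translate X : continuous (fun u : H => X + u).
Proof. by apply: cont_add; [exact: cont_cst|move=> u; exact: cvg_id]. Qed.

(** The minimum over the compact traceless ball is not on the sphere, hence it is critical along
    every traceless direction. Applied in turn near a point of the domain and on a large ball. *)
Lemma sphere_critical_point X0 y (r : R) : 0 < r -> hip hone y = 1 ->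
  (forall u, hip hone u = 0 -> `|u| = r ->
    Wfun X0 - hip X0 y < Wfun (X0 + u) - hip (X0 + u) y) ->
  exists u, [/\ hip hone u = 0, `|u| < r & chi (X0 + u) = y].
Proof.
move=> r0 ty hS.
pose Phi (u : H) := Wfun (X0 + u) - hip (X0 + u) y.
have cPhi : continuous Phi.
  apply: (@cont_sub R H R^o).
    by apply: (@cont_comp R H R^o); [exact: cont_translate|exact: W_continuous].
  by apply: (@cont_comp R H R^o _ _ (hip^~ y)); [exact: cont_translate|exact: hip_continuousl].
have [||u1 /set_mem[tu1 u1r] hmin] :=
    compact_EVT_min (f := Phi) _ (@traceless_ball_compact R n r).
- by exists 0; split; rewrite ?hip0r // normr0 ltW.
- exact: continuous_subspaceT.
have {}u1r : `|u1| < r.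
  rewrite lt_neqAle u1r andbT; apply/eqP => u1r'.
  have := hS _ tu1 u1r'; have : Phi u1 <= Phi 0.
    by apply: hmin; rewrite inE; split; rewrite ?hip0r // normr0 ltW.
  by rewrite /Phi addr0 leNgt => /negbTE ->.
exists u1; split=> //.
have crit v : hip hone v = 0 -> hip (chi (X0 + u1)) v = hip v y.
  move=> tv; have [->|v0] := eqVneq v 0; first by rewrite hip0r hip0l.
  pose f (s : R) := Wfun ((X0 + u1) + s *: v) - hip ((X0 + u1) + s *: v) y.
  have df s : is_derive s (1 : R) f (hip (chi ((X0 + u1) + s *: v)) v - hip v y).
    apply: is_deriveB; first exact: W_line_derive.
    have -> : hip v y = 'D_v (hip y) ((X0 + u1) + s *: v) by rewrite hip_derive hipC.
    under eq_fun do rewrite hipC.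
    apply: is_derive_line; apply: diff_derivable.
    by apply: linear_differentiable; exact: hip_continuous.
  have v0' : 0 < `|v| by rewrite normr_gt0.
  (* For |s| < [e] the point [u1 + s *: v] stays in the ball. *)
  pose e := (r - `|u1|) / `|v|.
  have e0 : 0 < e by rewrite divr_gt0 // subr_gt0.
  have [||||_ d0] := @derive1_at_min R f (- e) e 0.
  - by rewrite ltW // gtrN.
  - by move=> s _; case: (df s).
  - by rewrite in_itv /= oppr_lt0 e0.
  - move=> s; rewrite in_itv /= -ltr_norml => se.
    have := hmin (u1 + s *: v); rewrite /Phi /f scale0r addr0 addrA; apply.
    rewrite inE; split; first by rewrite hipDr hipZr tu1 tv mulr0 addr0.
    rewrite (le_trans (ler_normD _ _)) // normrZ -lerBrDl -ler_pdivlMr // ltW //.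
  have := @derive_val _ _ _ _ _ _ _ (df 0); rewrite d0 scale0r addr0 => /eqP.
  by rewrite eq_sym subr_eq0 => /eqP.
apply/eqP; rewrite -subr_eq0; apply/eqP/hip_eq0.
(* The difference of [chi (X0 + u1)] and [y] is itself traceless, so criticality along it makes its
   norm vanish. *)
have tv : hip hone (chi (X0 + u1) - y) = 0 by rewrite hipBr chi_trace ty subrr.
by rewrite hipBl crit // hipC subrr.
Qed.

(** By strict convexity and compactness [Psi] is at least some m > 0 on the sphere of radius r;
    passing from chi(X0) to a y closer than m / r tilts it there by less than m. The bound on u
    gives continuity of the inverse as well as openness of the image. *)
Lemma chi_local_inverse X0 (r : R) : 0 < r -> exists2 m, 0 < m &
  forall y, hip hone y = 1 -> `|y - chi X0| < m ->
    exists u, [/\ hip hone u = 0, `|u| < r & chi (X0 + u) = y].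
Proof.
move=> r0; pose Psi (u : H) := Wfun (X0 + u) - (Wfun X0 + hip (chi X0) u).
have cPsi : continuous Psi.
  apply: (@cont_sub R H R^o).
    by apply: (@cont_comp R H R^o); [exact: cont_translate|exact: W_continuous].
  by apply: (@cont_add R H R^o); [exact: (@cont_cst R H R^o)|exact: hip_continuous].
have [u tu ur|m m0 hm] := traceless_sphere_min cPsi (r := r).
  by rewrite subr_gt0 W_strict // -normr_gt0 [X in 0 < X]ur.
exists (m / r) => [|y ty ym]; first exact: divr_gt0.
apply: sphere_critical_point => // u tu ur.
have := hm u tu ur; rewrite /Psi => h.
have : hip u (y - chi X0) < m.
  apply: le_lt_trans (hip_le_norm _ _) _; rewrite [X in X * _]ur.
  by move: ym; rewrite ltr_pdivlMr // mulrC.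
rewrite hipBr => h'; rewrite hipDl; move: h; rewrite [hip (chi _) _]hipC; move: h'.
move: (hip u y) (hip u (chi X0)) (hip X0 y) (Wfun X0) (Wfun (X0 + u)) => a b c e f.
by lra.
Qed.

(* For traceless u of large norm, Z(u) e^(- <u, rho>) = \int e^<u, p - rho>
   dominates \int max (<u, p - rho>, 0), which is positively homogeneous in u. *)
Lemma chi_surjective rho : hip hone rho = 1 ->
  (forall u, hip hone u = 0 -> u != 0 -> exists2 p, K p & 0 < hip u (p - rho)) ->
  exists2 X, hip hone X = 0 & chi X = rho.
Proof.
move=> trho hrho.
pose pos (u p : H) : R := Num.max (hip u (p - rho)) 0.
have cont_lin (u : H) : continuous (fun p : H => hip u (p - rho)).
  under eq_fun do rewrite hipBr.
  by apply: (@cont_sub R H R^o); [exact: hip_continuous|exact: (@cont_cst R H R^o)].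
have cont_pos (u : H) : continuous (pos u).
  move=> p; apply: (continuous_max (f := fun p => hip u (p - rho)) (g := fun=> 0)).
    exact: cont_lin.
  exact: (@cont_cst R H R^o).
pose h (u : H) := mean (pos u).
have hlip (u v : H) : `|h u - h v| <= (1 + `|rho|) * `|u - v|.
  rewrite /h -(meanB Kclosed Knorm K1) //.
  apply: (norm_mean_le Kclosed Knorm K1); first exact: (@cont_sub R H R^o).
  move=> p Kp; apply: (@le_trans _ _ `|hip (u - v) (p - rho)|).
    by rewrite hipBl; exact: max0_lipschitz.
  apply: le_trans (hip_ler_norm _ _) _; rewrite mulrC; apply: ler_wpM2r => //.
  by apply: le_trans (ler_normB _ _) _; rewrite lerD2r Knorm.
have ch : continuous h.
  move=> u; apply/(@continuous_atP _ H R^o) => e e0.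
  have M0 : 0 < 1 + `|rho| by rewrite ltr_pwDl.
  exists (e / (1 + `|rho|)) => [|v]; first exact: divr_gt0.
  by rewrite ltr_pdivlMr // mulrC; exact: le_lt_trans (hlip u v).
(* If the mean of the nonnegative function [pos u] were 0, full support would make it vanish on [K],
   against the assumption on [rho]. *)
have hpos (u : H) : hip hone u = 0 -> `|u| = 1 -> 0 < h u.
  move=> tu u1; have u0 : u != 0 by rewrite -normr_gt0 [X in _ < X]u1.
  have pos0 p : K p -> 0 <= pos u p by rewrite le_max lexx orbT.
  rewrite lt_def Rintegral_ge0 // andbT; apply/eqP => h0.
  have [p Kp up] := hrho u tu u0.
  have : hip u (p - rho) <= pos u p by rewrite le_max lexx.
  by rewrite (Kfull (cont_pos u) pos0 h0 Kp) leNgt up.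
have [m m0 hm] := traceless_sphere_min ch hpos.
(* By homogeneity [h] is at least 2 on the sphere of radius [r], hence above the value 1 of Z(u)
   e^(-<u, rho>) at the origin. *)
pose r := 2 / m.
have r0 : 0 < r by rewrite divr_gt0.
have hr (u : H) : hip hone u = 0 -> `|u| = r -> 2 <= h u.
  move=> tu ur; have -> : h u = r * h (r^-1 *: u).
    rewrite /h -(meanZ Kclosed Knorm K1) //; apply: eq_mean => p _.
    rewrite /pos hipZl maxr_pMr; last exact: ltW.
    by rewrite mulrA mulfV ?gt_eqF // mul1r mulr0.
  have -> : 2 = r * m by rewrite /r mulfVK // gt_eqF.
  apply: ler_wpM2l; first exact: ltW.
  apply: hm; first by rewrite hipZr tu mulr0.
  by rewrite normrZ [X in _ * X]ur gtr0_norm ?invr_gt0 // mulVf // gt_eqF.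
have [u [tu _ cu]] : exists u, [/\ hip hone u = 0, `|u| < r & chi (0 + u) = rho].
  apply: sphere_critical_point => // u tu ur.
  have W0 : Wfun 0 = 0.
    rewrite /Wfun /Zfun -[RHS]ln1; congr ln; rewrite -[RHS](mean_cst Kclosed K1).
    by apply: eq_mean => p _; rewrite hip0l expR0.
  rewrite W0 hip0l subrr add0r subr_gt0 -[X in X < _]expRK /Wfun ltr_ln ?posrE ?expR_gt0 //.
  rewrite -[X in X < _]mul1r -ltr_pdivlMr ?expR_gt0 // -expRN.
  apply: (@lt_le_trans _ _ 2); first by rewrite ltr1n.
  apply: le_trans (hr u tu ur) _; rewrite mulrC /Zfun -(meanZ Kclosed Knorm K1); last first.
    exact: exp_hip_continuous.
  apply: (le_mean Kclosed Knorm K1) => //.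
    by apply: cont_mul; [exact: (@cont_cst R H R^o)|exact: exp_hip_continuous].
  move=> p Kp; rewrite -expRD addrC -hipBr /pos ge_max expR_ge0 andbT.
  by apply: le_trans (expR_ge1Dx _); rewrite lerDr.
by rewrite (add0r u) in cu; exists u.
Qed.

End Convexity.

(** * The convex hull *)

Section ConvexHull.
Context {R : realType} {n : nat}.
Local Notation H := (herm R n).
Implicit Types (A : set H) (x y : H).

Lemma convex_setP A : convex_set (A : set (convex_lmodType H)) <->
  forall x y (t : R), A x -> A y -> 0 <= t -> t <= 1 -> A (t *: x + (1 - t) *: y).
Proof.
split=> [cA x y t Ax Ay t0 t1|cA x y t].
  have := cA x y (Itv01 t0 t1); rewrite !inE; exact.
rewrite !inE => Ax Ay; exact: cA.
Qed.

Lemma hull_convex A x y (t : R) : let C := smallest (@convex_set R H) A in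
  C x -> C y -> 0 <= t -> t <= 1 -> C (t *: x + (1 - t) *: y).
Proof.
move=> C Cx Cy t0 t1 B [cB AB]; have /convex_setP := cB; apply=> //.
  exact: Cx.
exact: Cy.
Qed.

(** Dividing by the total weight keeps the induction free of any condition on the sum of the
    coefficients. *)
Lemma positive_convex_sum A : convex_set (A : set (convex_lmodType H)) ->
  forall k (c : 'I_k.+1 -> R) (p : 'I_k.+1 -> H),
  (forall i, 0 < c i) -> (forall i, A (p i)) ->
  A ((\sum_i c i)^-1 *: \sum_i c i *: p i).
Proof.
move=> /convex_setP cA; elim=> [|k IH] c p c0 Ap.
  by rewrite !big_ord1 scalerA mulVf ?gt_eqF // scale1r.
rewrite big_ord_recr [\sum_i c i *: p i]big_ord_recr /=.
set t := \sum_i c _; set s := \sum_i _ *: _; set e := c ord_max.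
have e0 : 0 < e by exact: c0.
have t0 : 0 < t.
  by rewrite /t big_ord_recl ltr_pwDl ?c0 // sumr_ge0 // => i _; exact: ltW.
have te0 : 0 < t + e by rewrite addr_gt0.
have -> : (t + e)^-1 *: (s + e *: p ord_max) =
    (t / (t + e)) *: (t^-1 *: s) + (1 - t / (t + e)) *: p ord_max.
  rewrite scalerDr !scalerA; congr (_ *: _ + _ *: _); field.
    by rewrite !gt_eqF.
  by rewrite gt_eqF.
apply: cA => //.
- by apply: IH.
- by rewrite divr_ge0 // ltW.
- by rewrite ler_pdivrMr // mul1r lerDl ltW.
Qed.

End ConvexHull.

(** * Finite spanning families and an interior point of the hull *)

Section SpanningFamily.
Context {R : realType} {n : nat}.
Local Notation H := (herm R n).
Context (K : set H) (p0 : H).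
Hypothesis Kp0 : K p0.
Hypothesis Ksep : forall Y, (forall p, K p -> hip Y p = 0) -> Y = 0.

Lemma hip_row (X Y : H) : hip X Y = (hcoord X *m (hcoord Y)^T) 0 0.
Proof. by rewrite hip_hcoord mxE; apply: eq_bigr => k _; rewrite [_^T _ _]mxE. Qed.

(** Take a family of maximal rank. If the rank were not full, some nonzero v would be orthogonal to
    the family, and an element of [K] not orthogonal to v would raise the rank. [T] makes the
    coefficients linear in X, which gives bounds on them. *)
Lemma spanning_family : exists k (p : 'I_k.+1 -> H) (T : 'M[R]_(n * n, k.+1)),
  (forall i, K (p i)) /\
  forall X, X = \sum_i (hcoord X *m T) 0 i *: p i.
Proof.
pose B k (p : 'I_k.+1 -> H) : 'M[R]_(k.+1, n * n) := \matrix_i hcoord (p i).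
pose Q r := `[< exists k (p : 'I_k.+1 -> H), (forall i, K (p i)) /\ \rank (B k p) = r >].
have exQ : exists r, Q r.
  by exists (\rank (B 0%N (fun=> p0))); apply/asboolP; exists 0%N, (fun=> p0).
have leQ r : Q r -> (r <= n * n)%N.
  by move=> /asboolP[k [p [_ <-]]]; exact: rank_leq_col.
case: (ex_maxnP exQ leQ) => r /asboolP[k [p [Kp rB]]] rmax.
have fullB : row_full (B k p).
  rewrite /row_full eqn_leq rank_leq_col /= leqNgt; apply/negP => rn.
  have : kermx (B k p)^T != 0.
    by rewrite -mxrank_eq0 mxrank_ker mxrank_tr subn_eq0 -ltnNge.
  move=> /rowV0Pn[v /sub_kermxP vB v0].
  have [p1 Kp1 vp1] : exists2 p1, K p1 & hip (hvec v) p1 != 0.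
    apply: contrapT => h; move/negP: v0; apply; rewrite -[v]hvecK.
    suff -> : hvec v = 0 by rewrite linear0.
    apply: Ksep => p1 Kp1; apply/eqP; apply: contrapT => /negP hp1.
    by apply: h; exists p1.
  pose p' (i : 'I_k.+2) := if unlift ord0 i is Some j then p j else p1.
  have BB' : (B k p < B k.+1 p')%MS.
    rewrite /ltmx; apply/andP; split.
      apply/row_subP => j.
      have -> : row j (B k p) = row (lift ord0 j) (B k.+1 p').
        by rewrite !rowK /p' liftK.
      exact: row_sub.
    apply/negP => /row_subP/(_ ord0); rewrite rowK /p' unlift_none.
    move=> /submxP[w wE]; move/eqP: vp1; apply.
    by rewrite hip_row hvecK wE trmx_mul mulmxA vB mul0mx mxE.
  have : Q (\rank (B k.+1 p')).
    apply/asboolP; exists k.+1, p'; split=> // i.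
    by rewrite /p'; case: unliftP.
  by move=> /rmax; rewrite -rB leqNgt (rank_ltmx BB').
have /row_fullP[T TB] := fullB.
exists k, p, T; split=> // X; apply: (can_inj hcoordK).
rewrite -[LHS]mulmx1 -TB mulmxA linear_sum /= mulmx_sum_row.
by apply: eq_bigr => i _; rewrite linearZ /= rowK.
Qed.

Hypothesis Ktrace : forall p, K p -> hip hone p = 1.
Local Notation C := (smallest (@convex_set R H) K).

Lemma norm_hbasis k : `|hbasis k : H| = 1.
Proof. by rewrite normhE hip_hbasis hvecK mxE !eqxx sqrtr1. Qed.

(** The point is the barycentre of a spanning family. Near it the coefficients stay close to 1 / (k
    + 1), hence positive, and pairing with [hone] shows that they sum to 1. *)
Lemma hull_interior_point : exists q, hip hone q = 1 /\ exists2 r, 0 < r &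
  forall y, hip hone y = 1 -> `|y - q| < r -> C y.
Proof.
have [k [p [T [Kp pE]]]] := spanning_family.
pose q := \sum_i k.+1%:R^-1 *: p i.
have k0 : 0 < k.+1%:R :> R by [].
have tq : hip hone q = 1.
  rewrite hip_sumr; under eq_bigr => i _ do rewrite hipZr (Ktrace (Kp i)) mulr1.
  by rewrite sumr_const card_ord -[LHS]mulr_natr mulVf // gt_eqF.
pose M := \sum_i \sum_a `|T a i| + 1.
have M0 : 0 < M by rewrite ltr_wpDl // !sumr_ge0 // => i _; rewrite sumr_ge0.
exists q; split=> //; exists (k.+1%:R^-1 / M) => [|y ty yq].
  by rewrite divr_gt0 // invr_gt0.
pose s i := (hcoord (y - q) *m T) 0 i.
have sM i : `|s i| < k.+1%:R^-1.
  move: yq; rewrite ltr_pdivlMr // => yq; apply: le_lt_trans yq.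
  apply: (@le_trans _ _ (`|y - q| * \sum_a `|T a i|)).
    rewrite /s mxE mulr_sumr (le_trans (ler_norm_sum _ _ _)) //.
    apply: ler_sum => a _; rewrite normrM ler_wpM2r // -hip_hbasis.
    by apply: le_trans (hip_ler_norm _ _) _; rewrite [X in _ * X]norm_hbasis mulr1.
  apply: ler_wpM2l => //; rewrite /M (bigD1 i) //= -addrA lerDl addr_ge0 //.
  by rewrite sumr_ge0 // => j _; rewrite sumr_ge0.
have yE : y = \sum_i (k.+1%:R^-1 + s i) *: p i.
  rewrite -[LHS](subrK q) [y - q]pE addrC /q -big_split /=.
  by apply: eq_bigr => i _; rewrite scalerDl.
have s1 : \sum_i (k.+1%:R^-1 + s i) = 1.
  apply: (etrans _ ty); rewrite [in RHS]yE hip_sumr; apply: eq_bigr => i _.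
  by rewrite hipZr Ktrace // mulr1.
have : C ((\sum_i (k.+1%:R^-1 + s i))^-1 *: \sum_i (k.+1%:R^-1 + s i) *: p i).
  apply: positive_convex_sum => [|i|i].
  - by apply/convex_setP; exact: hull_convex.
  - by have := sM i; rewrite ltr_norml => /andP[h _]; rewrite -ltrBlDl sub0r.
  - exact: (sub_gen_smallest (Kp i)).
by rewrite s1 invr1 scale1r -yE.
Qed.

End SpanningFamily.

(** * The image of chi is the relative interior of the hull *)

Section MeanParameters.
Context {R : realType} {n : nat}.
Local Notation H := (herm R n).
Context (K : set H) (sigma : probability (borel_herm R n) R).
Hypothesis Kclosed : closed K.
Hypothesis Knorm : forall p, K p -> `|p| <= 1.
Hypothesis K1 : sigma K = 1%E.
Hypothesis Ktrace : forall p, K p -> hip hone p = 1.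
Hypothesis Kfull : full_support K sigma.
Hypothesis Ksep : forall Y, (forall p, K p -> hip Y p = 0) -> Y = 0.
Local Notation chi := (chifun K sigma).
Local Notation C := (smallest (@convex_set R H) K).

Definition in_rel_interior (x : H) : Prop := hip hone x = 1 /\ exists2 r, 0 < r &
  forall y, hip hone y = 1 -> `|y - x| < r -> C y.

Lemma chi_mean_le X w (s : R) : (forall p, K p -> hip w p <= s) -> hip w (chi X) <= s.
Proof.
move=> ws; have Z0 := Zfun_gt0 Kclosed Knorm K1 X.
rewrite hipC (hip_chifun Kclosed Knorm K1) mulrC ler_pdivrMr //.
rewrite -(meanZ Kclosed Knorm K1); last exact: exp_hip_continuous.
apply: (le_mean Kclosed Knorm K1) => [||p Kp].
- by apply: zeta_integrand_continuous; exact: hip_continuous.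
- by apply: cont_mul; [exact: (@cont_cst R H R^o)|exact: exp_hip_continuous].
- by rewrite mulrC ler_wpM2r ?expR_ge0 ?ws.
Qed.

Lemma hull_norm c : C c -> `|c| <= 1.
Proof.
move: c; apply: smallest_sub => //; apply/convex_setP => x y t x1 y1 t0 t1 /=.
rewrite (le_trans (ler_normD _ _)) // !normrZ !ger0_norm ?subr_ge0 //.
apply: (@le_trans _ _ (t * 1 + (1 - t) * 1)); last by rewrite !mulr1 subrKC.
by apply: lerD; apply: ler_wpM2l; rewrite ?subr_ge0.
Qed.

Lemma hull_trace c : C c -> hip hone c = 1.
Proof.
move: c; apply: smallest_sub => //; apply/convex_setP => x y t /= x1 y1 t0 t1.
by rewrite hipDr !hipZr x1 y1 !mulr1 subrKC.
Qed.

(* Otherwise an almost nearest point c of the hull gives an affine function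
   which is almost nonpositive on K, while its mean is |chi X - c| ^ 2. *)
Lemma chi_in_hull_closure X (e : R) : 0 < e -> exists2 c, C c & `|c - chi X| < e.
Proof.
(* The reduction to e <= 1 ensures that the convex parameter t = e^2 / 8 below is at most 1. *)
wlog e1 : e / e <= 1 => [hw e0|e0].
  have m0 : 0 < Num.min 1 e by rewrite lt_min ltr01.
  have [|c Cc ce] := hw (Num.min 1 e) _ m0; first by rewrite ge_min lexx.
  by exists c => //; apply: lt_le_trans ce _; rewrite ge_min lexx orbT.
apply: contrapT => h; set x := chi X in h.
have he c : C c -> e <= `|c - x|.
  by move=> Cc; rewrite leNgt; apply/negP => ce; apply: h; exists c.
have [p Kp] := K_nonempty K1.
pose D := [set `|c - x| ^+ 2 | c in C].
have Dinf : has_inf D.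
  split; first by exists (`|p - x| ^+ 2); exists p => //; exact: sub_gen_smallest.
  by exists 0 => _ [c _ <-]; exact: sqr_ge0.
(* Averaging the bound [pc] will give 2 t |x - c|^2 <= eta + 4 t^2. With t = e^2 / 8 the right side
   is e^4 / 8, while |x - c| >= e makes the left side at least e^4 / 4. *)
pose eta := e ^+ 4 / 16.
have eta0 : 0 < eta by rewrite divr_gt0 // exprn_gt0.
have [_ [c Cc <-] cinf] := inf_adherent eta0 Dinf.
have infle c' : C c' -> inf D <= `|c' - x| ^+ 2.
  by move=> Cc'; apply: ge_inf; [exact: Dinf.2|exists c'].
pose t := e ^+ 2 / 8.
have t0 : 0 < t by rewrite divr_gt0 // exprn_gt0.
have t1 : t <= 1 by rewrite /t; nra.
have pc p' : K p' -> t * (2 * hip (x - c) (p' - c)) <= eta + t ^+ 2 * 4.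
  move=> Kp'; have Cp' : C p' by exact: sub_gen_smallest.
  have h1 := infle _ (hull_convex Cp' Cc (ltW t0) t1).
  have -> : t * (2 * hip (x - c) (p' - c)) =
      `|c - x| ^+ 2 - `|t *: p' + (1 - t) *: c - x| ^+ 2 + t ^+ 2 * `|p' - c| ^+ 2.
    have -> : t *: p' + (1 - t) *: c - x = (c - x) + t *: (p' - c).
      rewrite scalerBr scalerBl scale1r [t *: p' + _]addrC -!addrA; congr (_ + _).
      by rewrite addrCA [RHS]addrCA; congr (_ + _); rewrite addrC.
    have -> : hip (x - c) (p' - c) = - hip (c - x) (p' - c) by rewrite -hipNl opprB.
    rewrite !sqr_normh; move: (c - x) (p' - c) => a b.
    rewrite hipDl !hipDr !hipZl !hipZr (hipC b a).
    move: (hip a a) (hip a b) (hip b b) => aa ab bb; ring.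
  have h2 : `|p' - c| ^+ 2 <= 4.
    have : `|p' - c| <= 2.
      apply: le_trans (ler_normB _ _) _; rewrite -[2]/(1 + 1).
      by apply: lerD; [exact: Knorm|exact: hull_norm].
    by rewrite -(@ler_pXn2r _ 2) ?nnegrE // => /le_trans; apply; rewrite expr2 -natrM.
  apply: lerD; last by apply: ler_wpM2l => //; exact: sqr_ge0.
  by rewrite lerBlDl; apply: ltW (lt_le_trans cinf _); rewrite lerD2r.
have : hip (x - c) x <= (eta + t ^+ 2 * 4) / (t * 2) + hip (x - c) c.
  apply: chi_mean_le => p' Kp'; rewrite -lerBlDr -hipBr ler_pdivlMr ?mulr_gt0 //.
  by rewrite mulrC -mulrA; exact: pc.
rewrite -lerBlDr -hipBr ler_pdivlMr ?mulr_gt0 // -sqr_normh distrC.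
have := he _ Cc; rewrite -(@ler_pXn2r _ 2) ?nnegrE ?(ltW e0) // => h1 h2.
have e2 : 0 < e ^+ 2 by rewrite exprn_gt0.
have h3 : e ^+ 2 * (t * 2) <= eta + t ^+ 2 * 4.
  by apply: le_trans h2; apply: ler_wpM2r => //; rewrite mulr_ge0 // ltW.
by move: h3; rewrite /t /eta; nra.
Qed.

(** A point y near chi(X) is pushed away from an interior point q of the hull to z, still in the
    image of chi and so near some c of the hull. The error z - c is absorbed by moving q inside its
    ball, and y is a convex combination of c and the moved point. *)
Lemma chi_in_rel_interior X : in_rel_interior (chi X).
Proof.
split; first exact: chi_trace.
have [p Kp] := K_nonempty K1.
have [q [tq [r r0 hq]]] := hull_interior_point Kp Ksep Ktrace.
have [m m0 hm] := chi_local_inverse Kclosed Knorm K1 Ktrace Kfull Ksep X ltr01.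
exists (m / 2) => [|y ty yx]; first by rewrite divr_gt0.
(* With this [s] the push has length less than m / 2; the added 1 covers the case y = q. *)
pose s := m / (2 * (`|y - q| + 1)).
have a0 : 0 < `|y - q| + 1 by rewrite ltr_wpDl.
have s0 : 0 < s by rewrite divr_gt0 // mulr_gt0.
have sE : s * (`|y - q| + 1) = m / 2 by rewrite /s; field; rewrite gt_eqF.
pose z := y + s *: (y - q).
have tz : hip hone z = 1 by rewrite hipDr hipZr hipBr ty tq subrr mulr0 addr0.
have zx : `|z - chi X| < m.
  rewrite /z addrAC (le_lt_trans (ler_normD _ _)) //.
  rewrite [X in _ < X]splitr; apply: ltrD; first exact: yx.
  by rewrite normrZ (gtr0_norm s0) -sE (ltr_pM2l s0) ltrDl.
have [u [_ _ zE]] := hm z tz zx.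
have [c Cc cz] := chi_in_hull_closure (X + u) (mulr_gt0 s0 r0).
rewrite zE in cz.
(* Chosen so that c + s q' = z + s q = (1 + s) y; its distance to [q] is |z - c| / s < r. *)
pose q' := q + s^-1 *: (z - c).
have Cq' : C q'.
  apply: hq; first by rewrite hipDr hipZr hipBr tz (hull_trace Cc) subrr mulr0 addr0.
  rewrite /q' addrAC subrr add0r normrZ gtr0_norm ?invr_gt0 // distrC.
  by rewrite mulrC ltr_pdivrMr // mulrC.
have -> : y = (1 + s)^-1 *: c + (1 - (1 + s)^-1) *: q'.
  have s1 : 1 + s != 0 by rewrite gt_eqF // addr_gt0.
  have -> : 1 - (1 + s)^-1 = (1 + s)^-1 * s by field.
  have sq' : s *: q' = s *: q + (z - c).
    by rewrite /q' scalerDr scalerA mulfV ?gt_eqF // scale1r.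
  rewrite -scalerA -scalerDr sq' addrCA [c + _]addrC subrK.
  have -> : s *: q + z = (1 + s) *: y.
    by rewrite /z scalerDl scale1r scalerBr addrCA [s *: q + _]addrC subrK.
  by rewrite scalerA mulVf // scale1r.
apply: hull_convex => //; first by rewrite invr_ge0 addr_ge0 // ltW.
by rewrite invf_le1 ?addr_gt0 // lerDl ltW.
Qed.

(** Otherwise <u, .> is at most <u, rho> on [K], hence on the hull, although the hull contains rho +
    s u for a small s > 0. *)
Lemma rel_interior_support rho : in_rel_interior rho ->
  forall u, hip hone u = 0 -> u != 0 -> exists2 p, K p & 0 < hip u (p - rho).
Proof.
move=> [trho [r r0 hr]] u tu u0; apply: contrapT => h.
have hK p : K p -> hip u p <= hip u rho.
  move=> Kp; rewrite leNgt; apply/negP => lt; apply: h.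
  by exists p => //; rewrite hipBr subr_gt0.
have hC c : C c -> hip u c <= hip u rho.
  move: c; apply: smallest_sub => //; apply/convex_setP => x y t /= x1 y1 t0 t1.
  rewrite hipDr !hipZr.
  have -> : hip u rho = t * hip u rho + (1 - t) * hip u rho by ring.
  by apply: lerD; apply: ler_wpM2l; rewrite ?subr_ge0.
have nu : 0 < `|u| by rewrite normr_gt0.
pose s := r / 2 / `|u|; have s0 : 0 < s by rewrite !divr_gt0.
have := hC (rho + s *: u); rewrite hipDr hipZr -sqr_normh gerDl leNgt.
rewrite mulr_gt0 ?exprn_gt0 //= => /(_ _)/negP; apply.
  apply: hr; first by rewrite hipDr hipZr tu mulr0 addr0.
  rewrite addrAC subrr add0r normrZ gtr0_norm // /s divfK ?gt_eqF //.
  by rewrite ltr_pdivrMr // ltr_pMr // ltr1n.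
by [].
Qed.

Lemma chi_onto rho : in_rel_interior rho ->
  exists2 X, hip hone X = 0 & chi X = rho.
Proof.
move=> hrho; apply: chi_surjective => //; last exact: rel_interior_support.
by case: hrho.
Qed.

End MeanParameters.

(** * Smoothness of chi and of its inverse *)

Section DirectionalDerivative.
Context {R : realType} {V W : normedModType R}.

Lemma is_deriveP (f : V -> W) y v w : is_derive y v f w <->
  forall e, 0 < e -> exists2 r : R, 0 < r &
    forall t, `|t| < r -> `|f (y + t *: v) - f y - t *: w| <= e * `|t|.
Proof.
split=> [[fd <-] e e0|fw].
  have /cvgrPdist_le/(_ e e0) := fd.
  rewrite /dnbhs /within /= => /nbhs_normP[r r0 hr]; exists r => // t tr.
  have [->|t0] := eqVneq t 0.
    by rewrite !scale0r addr0 subrr subr0 !normr0 mulr0.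
  have := hr t; rewrite /= sub0r normrN => /(_ tr t0).
  rewrite [y + _]addrC => h.
  have -> : f (t *: v + y) - f y - t *: 'D_v f y =
      - (t *: ('D_v f y - t^-1 *: (f (t *: v + y) - f y))).
    by rewrite scalerBr scalerA mulfV // scale1r opprB.
  by rewrite normrN normrZ mulrC ler_wpM2r.
have fl : (fun h : R => h^-1 *: ((f \o shift y) (h *: v) - f y)) @ 0^' --> w.
  apply/cvgrPdist_le => e e0; have [r r0 hr] := fw e e0.
  rewrite /dnbhs /within /=; apply/nbhs_normP; exists r => // t /=.
  rewrite sub0r normrN => tr t0; have := hr t tr.
  rewrite [y + _]addrC => h.
  have -> : w - t^-1 *: (f (t *: v + y) - f y) =
      - (t^-1 *: (f (t *: v + y) - f y - t *: w)).
    by rewrite !scalerBr !scalerA mulVf // scale1r !opprB.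
  by rewrite normrN normrZ normfV mulrC ler_pdivrMr ?normr_gt0.
by split; [apply/cvg_ex; exists w|exact: cvg_lim].
Qed.

Lemma derive_line (f : V -> W) y v :
  'D_v f y = 'D_1 (fun h : R => f (h *: v + y)) 0.
Proof.
rewrite /derive; set g1 := fun h => h^-1 *: _; set g2 := fun h => h^-1 *: _.
suff -> : g1 = g2 by [].
by rewrite funeqE /g1 /g2 => h /=; rewrite addr0 scale0r add0r [_%:A]mulr1.
Qed.

End DirectionalDerivative.

Section DirectionalDerivativeTheory.
Context {R : realType} {U V W : normedModType R}.

Lemma is_derive_scale (k : V -> R) (c : W) y v (dk : R) :
  is_derive y v k dk -> is_derive y v (fun z => k z *: c) (dk *: c).
Proof.
move=> /(@is_deriveP R V R^o) kd; apply/is_deriveP => e e0.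
have c0 : 0 < `|c| + 1 by rewrite ltr_wpDl.
have [r r0 hr] := kd _ (divr_gt0 e0 c0); exists r => // t tr.
have -> : k (y + t *: v) *: c - k y *: c - t *: (dk *: c) =
    (k (y + t *: v) - k y - t *: (dk : R^o)) *: c.
  by rewrite scalerA -!scalerBl.
rewrite normrZ; apply: le_trans (ler_wpM2r (normr_ge0 _) (hr t tr)) _.
rewrite mulrAC ler_wpM2r // -mulrA ger_pMr // mulrC ler_pdivrMr // mul1r.
by rewrite lerDl.
Qed.

Lemma is_derive_sum_seq (I : Type) (s : seq I) (f : I -> V -> W) y v (df : I -> W) :
  (forall i, is_derive y v (f i) (df i)) ->
  is_derive y v (fun z => \sum_(i <- s) f i z) (\sum_(i <- s) df i).
Proof.
move=> fd; elim: s => [|i s IH].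
  by rewrite big_nil; under eq_fun do rewrite big_nil; exact: is_derive_cst.
by rewrite big_cons; under eq_fun do rewrite big_cons; exact: is_deriveD.
Qed.

(** A chain rule in which the inner function need only have a derivative along v, as the inverse of
    chi does; composing with the line through y reduces it to the chain rule for differentiable
    maps. *)
Lemma is_derive_comp_diff (f : V -> W) (g : U -> V) y v w :
  is_derive y v g w -> differentiable f (g y) ->
  is_derive y v (fun z => f (g z)) ('d f (g y) w).
Proof.
move=> [gd gE] fd.
have gd1 := gd; move/derivable1P : gd1 => gd1.
pose c (t : R) := g (t *: v + y).
have c0 : c 0 = g y by rewrite /c scale0r add0r.
have cd : differentiable c (0 : R) by apply/derivable1_diffP; exact: gd1.
have fd' : differentiable f (c 0) by rewrite c0.
have cE : 'D_1 c 0 = w by rewrite -gE [RHS]derive_line.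
have cE' : 'd c (0 : R) 1 = w by rewrite -deriveE.
have fc := differentiable_comp cd fd'.
split; first by apply/derivable1P/derivable1_diffP; exact: fc.
rewrite derive_line -[LHS]/('D_1 (f \o c) 0) deriveE //.
by rewrite (diff_comp cd fd') /= cE' c0.
Qed.

(** Agreement on a short segment suffices, so formulas valid only on a relatively open set can be
    differentiated along it. *)
Lemma is_derive_along (f f' : V -> W) y v w (r : R) : 0 < r ->
  (forall t : R, `|t| < r -> f (y + t *: v) = f' (y + t *: v)) ->
  is_derive y v f' w -> is_derive y v f w.
Proof.
move=> r0 ff' /is_deriveP fd; apply/is_deriveP => e e0.
have fy : f y = f' y by have := ff' 0; rewrite normr0 scale0r addr0; exact.
have [r' r'0 hr'] := fd e e0; exists (Num.min r r') => [|t].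
  by rewrite lt_min r0.
by rewrite lt_min => /andP[tr tr']; rewrite ff' // fy hr'.
Qed.

End DirectionalDerivativeTheory.

Section Estimates.
Context {R : realType}.
Implicit Types M e w a b t : R.

Lemma small_factor M e w : 0 <= M -> 0 < e -> 0 <= w ->
  exists2 eps, 0 < eps & M * eps <= 1 / 2 /\ M * eps * w <= e / 2.
Proof.
move=> M0 e0 w0; exists (Num.min 1 (e / (w + 1)) / (2 * (M + 1))).
  by rewrite divr_gt0 ?lt_min ?ltr01 ?divr_gt0 ?mulr_gt0 ?ltr_wpDl.
have M1 : 0 < M + 1 by rewrite ltr_wpDl.
have w1 : 0 < w + 1 by rewrite ltr_wpDl.
set m := Num.min _ _; have m1 : m <= 1 by rewrite ge_min lexx.
have mw : m * (w + 1) <= e by rewrite -ler_pdivlMr // ge_min lexx orbT.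
have m0 : 0 <= m by rewrite le_min ler01 divr_ge0 // ltW.
have Mq1 : M / (M + 1) <= 1 by rewrite ler_pdivrMr // mul1r lerDl.
have Mq0 : 0 <= M / (M + 1) by rewrite divr_ge0 // ltW.
have -> : M * (m / (2 * (M + 1))) = M / (M + 1) * (m / 2).
  by clearbody m; field; rewrite gt_eqF.
move: (M / (M + 1)) Mq0 Mq1 => q q0 q1; clearbody m; split; nra.
Qed.

(** Substituting the bound on b gives a <= M (t w + a); since M <= 1 / 2, half of a is absorbed on
    the left. In [inverse_derive] a is the error of the linear approximation and b the increment of
    the inverse. *)
Lemma contraction_estimate M e w t a b : 0 <= M -> 0 <= t -> 0 <= a ->
  M <= 1 / 2 -> M * w <= e / 2 -> b <= t * w + a -> a <= M * b -> a <= e * t.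
Proof.
move=> M0 t0 a0 M2 Mw bt ab.
have h1 := ler_wpM2l M0 bt; have h2 := ler_wpM2r a0 M2; have h3 := ler_wpM2r t0 Mw.
lra.
Qed.

End Estimates.

(** * Derivatives of all orders for chi and its inverse *)

Section Smoothness.
Context {R : realType} {n : nat}.
Local Notation H := (herm R n).
Context (K : set H) (sigma : probability (borel_herm R n) R).
Implicit Types (X Y u v w h y z : H).
Hypothesis Kclosed : closed K.
Hypothesis Knorm : forall p, K p -> `|p| <= 1.
Hypothesis K1 : sigma K = 1%E.
Hypothesis Ktrace : forall p, K p -> hip hone p = 1.
Hypothesis Kfull : full_support K sigma.
Hypothesis Ksep : forall Y, (forall p, K p -> hip Y p = 0) -> Y = 0.
Local Notation chi := (chifun K sigma).
Local Notation smooth_alg := (smooth_alg K sigma).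
Local Notation D := (in_rel_interior K).
Let sa_diff := sa_diff Kclosed Knorm K1.
Let sa_cont := sa_continuous Kclosed Knorm K1.
Let sa_der := sa_derive Kclosed Knorm K1.

Lemma comb_continuous (h : 'I_(n * n) -> H -> R) : (forall a, smooth_alg (h a)) ->
  continuous (fun X => \sum_a h a X *: hbasis a : H).
Proof.
move=> hh; apply: cont_sum => a; apply: cont_scale; last exact: cont_cst.
exact: sa_cont.
Qed.

Lemma comb_differentiable (h : 'I_(n * n) -> H -> R) : (forall a, smooth_alg (h a)) ->
  forall X, differentiable (fun X => \sum_a h a X *: hbasis a : H) X.
Proof.
move=> hh X; elim: (index_enum _) => [|a s IH].
  by under eq_fun do rewrite big_nil; exact: differentiable_cst.
under eq_fun do rewrite big_cons.
apply: differentiableD; last exact: IH.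
by apply: differentiableZl; exact: sa_diff.
Qed.

(** The induction common to chi, with g the identity, and to its inverse g: if derivatives of
    f(g(y)) have the form f'(g(y)) with f' again in [smooth_alg], one step of differentiation only
    changes the coefficients [h]. *)
Lemma Ck_on_smooth_alg (L E : set H) (g : H -> H) :
  (forall y, E y -> forall e, 0 < e -> exists2 r, 0 < r &
    forall z, E z -> `|y - z| < r -> `|g y - g z| < e) ->
  (forall y v, E y -> L v -> exists2 r : R, 0 < r &
    forall t, `|t| < r -> E (y + t *: v)) ->
  (forall f v, smooth_alg f -> L v -> exists2 f', smooth_alg f' &
    forall y, E y -> is_derive y v (fun z => f (g z)) (f' (g y))) ->
  forall k (h : 'I_(n * n) -> H -> R) (phi : H -> H),
  (forall a, smooth_alg (h a)) ->
  (forall y, E y -> phi y = \sum_a h a (g y) *: hbasis a) ->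
  Ck_on k L E phi.
Proof.
move=> gcont Eopen gder.
have cphi (h : 'I_(n * n) -> H -> R) phi : (forall a, smooth_alg (h a)) ->
    (forall y, E y -> phi y = \sum_a h a (g y) *: hbasis a) ->
    {within E, continuous phi}.
  move=> hh phiE; apply/subspace_continuousP => y Ey; apply/cvgrPdist_lt => e e0.
  have /(@continuous_atP _ H H)/(_ e e0)[r r0 hr] := @comb_continuous h hh (g y).
  have [r' r'0 hr'] := gcont y Ey r r0.
  rewrite /within /=; apply/nbhs_normP; exists r' => // z yz Ez.
  by have := hr (g z) (hr' z Ez yz); rewrite -(phiE _ Ey) -(phiE _ Ez).
elim=> [|k IH] h phi hh phiE; first by split=> //; exact: cphi phiE.
split; first exact: cphi phiE.
move=> v Lv.
have /choice[h' hh'] : forall a, exists f', smooth_alg f' /\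
    forall y, E y -> is_derive y v (fun z => h a (g z)) (f' (g y)).
  by move=> a; have [f' ? ?] := gder _ _ (hh a) Lv; exists f'.
have dphi y : E y -> is_derive y v phi (\sum_a h' a (g y) *: hbasis a).
  move=> Ey; have [r r0 hr] := Eopen y v Ey Lv.
  apply: (@is_derive_along _ _ _ _ (fun z => \sum_a h a (g z) *: hbasis a) _ _ _ r) => //.
    by move=> t tr; rewrite phiE //; exact: hr.
  by apply: is_derive_sum_seq => a; apply: is_derive_scale; have [_] := hh' a; exact.
split=> [y Ey|]; first by case: (dphi y Ey).
apply: (IH h') => [a|y Ey]; first by have [] := hh' a.
by case: (dphi y Ey).
Qed.

Lemma chi_comb X : chi X = \sum_a hip (chi X) (hbasis a) *: hbasis a.
Proof. exact: hip_decomp. Qed.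

Lemma chi_smooth k : Ck_on k (traceless R n) (traceless R n) chi.
Proof.
apply: (@Ck_on_smooth_alg _ _ id _ _ _ _ (fun a X => hip (chi X) (hbasis a))).
- by move=> y _ e e0; exists e.
- move=> y v /tracelessP ty /tracelessP tv; exists 1 => // t _.
  by apply/tracelessP; rewrite hipDr hipZr ty tv mulr0 addr0.
- move=> f v hf _; exists (fun X => 'D_v f X); first exact: sa_der.
  by move=> y _; apply: derivableP; apply: diff_derivable; exact: sa_diff.
- by move=> a; exact: sa_hip_chifun.
- by move=> y _; exact: chi_comb.
Qed.

(* On the traceless operators this is chi; the added term makes its differential
   invertible on the whole space. *)
Definition chi_ext X : H := chi X + hip hone X *: hone.

Lemma sa_chi_ext v : smooth_alg (fun X => hip (chi_ext X) v).
Proof.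
under eq_fun do rewrite hipDl hipZl.
apply: sa_add; first exact: sa_hip_chifun.
by apply: sa_mul; [exact: sa_hip|exact: sa_cst].
Qed.

Lemma chi_ext_differentiable X : differentiable chi_ext X.
Proof.
have -> : chi_ext = fun X => \sum_a hip (chi_ext X) (hbasis a) *: hbasis a.
  by apply/funext => Y; exact: hip_decomp.
by apply: comb_differentiable => a; exact: sa_chi_ext.
Qed.

Lemma hip_diff_chi_ext X u v :
  hip ('d chi_ext X u) v = cov K sigma X u v + hip hone u * hip hone v.
Proof.
have dF : is_derive X u chi_ext ('d chi_ext X u).
  have dd := chi_ext_differentiable X.
  by split; [apply: diff_derivable; exact: dd|apply: deriveE; exact: dd].
have ch : continuous (hip v : H -> R) by exact: hip_continuous.
have [_ dE] := is_derive_comp_diff dF (linear_differentiable (chi_ext X) ch).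
rewrite diff_lin // in dE; rewrite hipC -dE.
have -> : (fun z => hip v (chi_ext z)) =
    (fun z => hip (chi z) v + hip hone v * hip hone z).
  by apply/funext => z; rewrite hipDr hipZr hipC (hipC v hone) mulrC.
rewrite deriveD.
- rewrite /cov; congr (_ + _).
  rewrite deriveMl ?hip_derive; first by rewrite /GRing.scale /= mulrC.
  exact/diff_derivable/sa_diff/sa_hip.
- exact/diff_derivable/sa_diff/sa_hip_chifun.
- apply/diff_derivable/sa_diff; apply: sa_mul; [exact: sa_cst|exact: sa_hip].
Qed.

Definition cov_mx X : 'M[R]_(n * n) :=
  \matrix_(a, b) hip ('d chi_ext X (hbasis a)) (hbasis b).

Lemma sa_cov_mx a b : smooth_alg (fun X => cov_mx X a b).
Proof.
under eq_fun do rewrite mxE hip_diff_chi_ext.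
apply: sa_add; last exact: sa_cst.
exact: (sa_der (sa_hip_chifun Kclosed Knorm K1 (hbasis b)) (hbasis a)).
Qed.

Lemma hcoord_diff_chi_ext X u : hcoord ('d chi_ext X u) = hcoord u *m cov_mx X.
Proof.
apply/rowP => b; rewrite -hip_hbasis mxE.
rewrite [u in LHS](hip_decomp u) linear_sum /= hipC hip_sumr.
by apply: eq_bigr => a _; rewrite linearZ /= hipZr hip_hbasis [cov_mx _ _ _]mxE hipC.
Qed.

(** A vector in the kernel would annihilate the quadratic form of the differential, which is
    positive definite by [cov_gt0]. *)
Lemma cov_mx_unit X : cov_mx X \in unitmx.
Proof.
rewrite -row_free_unit -kermx_eq0; apply/eqP/row_matrixP => i; rewrite row0.
set w := row i _; have wC : w *m cov_mx X = 0.
  by apply/sub_kermxP; exact: row_sub.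
have dw0 : 'd chi_ext X (hvec w) = 0.
  by apply: (can_inj hcoordK); rewrite hcoord_diff_chi_ext hvecK wC linear0.
rewrite -[w]hvecK; suff -> : hvec w = 0 by rewrite linear0.
apply/eqP; apply/negPn/negP => w0.
have := cov_gt0 Kclosed Knorm K1 Ktrace Kfull Ksep X w0.
by rewrite expr2 -hip_diff_chi_ext dw0 hip0l ltxx.
Qed.

(** Cramer's rule: cofactors and determinant are polynomials in the entries, and the determinant
    vanishes nowhere. *)
Lemma sa_inv_cov_mx a b : smooth_alg (fun X => invmx (cov_mx X) a b).
Proof.
have -> : (fun X => invmx (cov_mx X) a b) =
    (fun X => (\det (cov_mx X))^-1 * ((-1) ^+ (b + a) * \det (row' b (col' a (cov_mx X))))).
  by apply/funext => X; rewrite /invmx cov_mx_unit mxE [\adj _ _ _]mxE.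
apply: sa_mul.
  apply: sa_inv => [|X]; first by apply: sa_det => i j; exact: sa_cov_mx.
  by have := cov_mx_unit X; rewrite unitmxE unitfE.
apply: sa_mul; first exact: sa_cst.
apply: sa_det => i j.
under eq_fun do rewrite [row' _ _ _ _]mxE [col' _ _ _ _]mxE.
exact: sa_cov_mx.
Qed.

Definition dchi_inv v X : H := hvec (hcoord v *m invmx (cov_mx X)).

Lemma dchi_invK v X : 'd chi_ext X (dchi_inv v X) = v.
Proof.
apply: (can_inj hcoordK).
by rewrite hcoord_diff_chi_ext hvecK mulmxKV // cov_mx_unit.
Qed.

Lemma sa_dchi_inv v a : smooth_alg (fun X => hip (dchi_inv v X) (hbasis a)).
Proof.
under eq_fun do rewrite hip_hbasis hvecK mxE.
by apply: sa_sum => b; apply: sa_mul; [exact: sa_cst|exact: sa_inv_cov_mx].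
Qed.

Lemma norm_le_hcoord u : `|u| <= \sum_a `|hcoord u 0 a|.
Proof.
rewrite {1}[u]hip_decomp; apply: le_trans (ler_norm_sum _ _ _) _.
apply: ler_sum => a _; rewrite normrZ hip_hbasis.
by rewrite -[leRHS]mulr1 ler_wpM2l // [X in X <= _]norm_hbasis.
Qed.

Lemma diff_chi_ext_bounded_below X : exists2 M, 0 <= M &
  forall u, `|u| <= M * `|'d chi_ext X u|.
Proof.
exists (\sum_a \sum_b `|invmx (cov_mx X) b a|) => [|u].
  by apply: sumr_ge0 => a _; apply: sumr_ge0.
apply: le_trans (norm_le_hcoord u) _; rewrite mulr_suml; apply: ler_sum => a _.
have -> : hcoord u = hcoord ('d chi_ext X u) *m invmx (cov_mx X).
  by rewrite hcoord_diff_chi_ext mulmxK // cov_mx_unit.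
rewrite mxE mulr_suml (le_trans (ler_norm_sum _ _ _)) //.
apply: ler_sum => b _; rewrite normrM mulrC; apply: ler_wpM2l => //.
rewrite -hip_hbasis; apply: le_trans (hip_ler_norm _ _) _.
by rewrite -[leRHS]mulr1 ler_wpM2l // [X in X <= _]norm_hbasis.
Qed.

Lemma rel_interior_segment y v : D y -> hip hone v = 0 ->
  exists2 r : R, 0 < r & forall t, `|t| < r -> D (y + t *: v).
Proof.
move=> [ty [r r0 hr]] tv.
have v0 : 0 < `|v| + 1 by rewrite ltr_wpDl.
exists (r / 2 / (`|v| + 1)) => [|t tr]; first by rewrite !divr_gt0.
split; first by rewrite hipDr hipZr ty tv mulr0 addr0.
exists (r / 2) => [|z tz zy]; first by rewrite divr_gt0.
apply: hr => //; rewrite [X in _ < X]splitr.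
have -> : z - y = (z - (y + t *: v)) + t *: v by rewrite opprD addrA subrK.
apply: le_lt_trans (ler_normD _ _) _; apply: (ltr_leD zy).
rewrite normrZ; move: tr; rewrite ltr_pdivlMr // => /ltW; apply: le_trans.
by rewrite ler_wpM2l // lerDl.
Qed.

Context (g : H -> H).
Hypothesis gP : forall y, D y -> hip hone (g y) = 0 /\ chi (g y) = y.

Lemma inverse_continuous y : D y -> forall e, 0 < e -> exists2 r, 0 < r &
  forall z, D z -> `|y - z| < r -> `|g y - g z| < e.
Proof.
move=> Dy e e0; have [tgy cgy] := gP Dy.
have [m m0 hm] := chi_local_inverse Kclosed Knorm K1 Ktrace Kfull Ksep (g y) e0.
exists m => // z Dz yz; have [tgz cgz] := gP Dz.
have [|u [tu ue zE]] := hm z Dz.1; first by rewrite cgy distrC.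
have -> : g z = g y + u.
  apply: (chi_inj Kclosed Knorm K1 Ktrace Kfull Ksep); last by rewrite cgz zE.
  by rewrite hipBr hipDr tgz tgy tu addr0 subrr.
by rewrite opprD addrA subrr add0r normrN.
Qed.

(** On [D] the map [chi_ext] inverts g. Its expansion at g(y), evaluated at the increment h of g,
    compares h with t w, and the lower bound on the differential turns this into an estimate of t w
    - h. *)
Lemma inverse_derive y v : D y -> hip hone v = 0 ->
  is_derive y v g (dchi_inv v (g y)).
Proof.
move=> Dy tv; apply/is_deriveP => e e0; set w := dchi_inv v (g y).
have [tgy cgy] := gP Dy.
have [M M0 hM] := diff_chi_ext_bounded_below (g y).
have [eps eps0 [Me Mew]] := small_factor M0 e0 (normr_ge0 w).
have [r1 r10 hr1] := diff_frechet (chi_ext_differentiable (g y)) eps0.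
have [r2 r20 hr2] := inverse_continuous Dy r10.
have [r3 r30 hr3] := rel_interior_segment Dy tv.
have v1 : 0 < `|v| + 1 by rewrite ltr_wpDl.
(* [r3] keeps the moved point in [D]; the other bound keeps it within [r2] of [y], so that
   continuity of [g] puts the increment [h] in the range [r1] of the expansion. *)
exists (Num.min r3 (r2 / (`|v| + 1))) => [|t]; first by rewrite lt_min r30 divr_gt0.
rewrite lt_min ltr_pdivlMr // => /andP[tr3 tr2].
have Dz := hr3 t tr3; have [tgz cgz] := gP Dz.
set z := y + t *: v in Dz tgz cgz *.
have yz : `|y - z| < r2.
  rewrite /z opprD addrA subrr add0r normrN normrZ; apply: le_lt_trans tr2.
  by rewrite ler_wpM2l // lerDl.
set h := g z - g y.
have gh : g y + h = g z by rewrite /h addrCA subrr addr0.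
have Fz : chi_ext (g z) = z by rewrite /chi_ext tgz scale0r addr0 cgz.
have Fy : chi_ext (g y) = y by rewrite /chi_ext tgy scale0r addr0 cgy.
have zy : z - y = t *: v by rewrite /z addrAC subrr add0r.
have hr1' : `|h| < r1 by rewrite /h distrC; exact: hr2.
have := hr1 h hr1'.
have -> : chi_ext (g y + h) - chi_ext (g y) - 'd chi_ext (g y) h =
    'd chi_ext (g y) (t *: w - h).
  by rewrite gh Fz Fy [RHS]linearB linearZ /= dchi_invK zy.
move=> dh; rewrite distrC.
have hle : `|h| <= `|t| * `|w| + `|t *: w - h|.
  by rewrite -normrZ -{1}[h](subKr (t *: w)) ler_normB.
have ab : `|t *: w - h| <= M * eps * `|h|.
  rewrite -mulrA; apply: (le_trans (hM (t *: w - h))).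
  by apply: ler_wpM2l; [exact: M0|exact: dh].
have Meps0 : 0 <= M * eps by exact: mulr_ge0 M0 (ltW eps0).
exact: contraction_estimate Meps0 (normr_ge0 t) (normr_ge0 _) Me Mew hle ab.
Qed.

Lemma inverse_smooth k : Ck_on k (traceless R n) D g.
Proof.
apply: (@Ck_on_smooth_alg _ _ g _ _ _ _ (fun a X => hip (hbasis a) X)).
- exact: inverse_continuous.
- by move=> y v Dy /tracelessP tv; exact: rel_interior_segment.
- move=> f v hf /tracelessP tv.
  exists (fun X => \sum_a hip (dchi_inv v X) (hbasis a) * 'D_(hbasis a) f X).
    by apply: sa_sum => a; apply: sa_mul; [exact: sa_dchi_inv|exact: sa_der].
  move=> y Dy.
  have fd := sa_diff hf (g y).
  (* The chain rule's value, with the derivative of [g] expanded in the basis, is a function of g(y)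
     built from [smooth_alg]. *)
  have <- : 'd f (g y) (dchi_inv v (g y)) =
      \sum_a hip (dchi_inv v (g y)) (hbasis a) * 'D_(hbasis a) f (g y).
    rewrite {1}[dchi_inv v (g y)]hip_decomp linear_sum /=.
    by apply: eq_bigr => a _; rewrite linearZ /= -deriveE.
  exact: is_derive_comp_diff (inverse_derive Dy tv) fd.
- by move=> a; exact: sa_hip.
- by move=> y _; rewrite {1}[g y]hip_decomp; apply: eq_bigr => a _; rewrite hipC.
Qed.

End Smoothness.

(** * The theorem *)

Section SeparableInterior.
Context {R : realType} {N : nat} {d : 'I_N -> nat}.
Local Notation n := (tensor_dim d).
Local Notation H := (herm R n).
Local Notation P := (product_states R d).

(** Positivity and unit trace are convex conditions satisfied by product states; hence [separable]
    is the whole hull. *)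
Lemma hull_density (X : H) : convex_hull P X -> density X.
Proof.
move=> CX; split; last first.
  rewrite trace_hone (_ : hip hone X = 1) //; move: CX.
  by apply: hull_trace; exact: product_states_trace.
move: X CX; apply: smallest_sub; last by move=> X; exact: product_states_psd.
apply/convex_setP => X Y t Xp Yp t0 t1 v.
rewrite hmxD !hmxZ mulmxDr mulmxDl -!scalemxAr -!scalemxAl mxE.
by rewrite addr_ge0 // mxE mulr_ge0 // ?Xp ?Yp // lecR ?subr_ge0.
Qed.

(** At a point of the hyperplane, neighbourhoods for the subspace topology are traces of balls,
    which gives the metric form of the interior. *)
Lemma separable_interiorE : separable_interior R d = [set X | in_rel_interior P X].
Proof.
have sepE (Y : H) : hip hone Y = 1 -> separable R d Y <-> convex_hull P Y.
  by move=> tY; split=> [[]//|CY]; split=> //; exact: hull_density.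
apply/seteqP; split=> X.
  rewrite /separable_interior /interior /= => nX.
  have sX : separable R d X by exact: nbhs_singleton nX.
  have tX : trace_one R n X by case: sX => -[].
  split; first exact/trace_oneP.
  have : within (trace_one R n) (nbhs X) (separable R d).
    by rewrite (nbhs_subspace_in tX); exact: nX.
  rewrite /within /= => /nbhs_normP[r r0 hr].
  exists r => // Y tY YX; apply/sepE => //; apply: hr; last exact/trace_oneP.
  by rewrite /= distrC.
move=> [tX [r r0 hr]].
have tX' : trace_one R n X by exact/trace_oneP.
suff : within (trace_one R n) (nbhs X) (separable R d).
  by rewrite (nbhs_subspace_in tX').
rewrite /within /=; apply/nbhs_normP; exists r => // Y /= XY tY.
have tY' : hip hone Y = 1 by exact/trace_oneP.
by apply/(sepE _ tY'); apply: (hr _ tY'); rewrite distrC.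
Qed.

End SeparableInterior.

Section MatrixIntegral.
Context {R : realType} {N : nat} {d : 'I_N -> nat}.
Local Notation n := (tensor_dim d).
Local Notation H := (herm R n).
Local Notation P := (product_states R d).
Context (sigma : probability (borel_herm R n) R).
Hypothesis sigma_supp : sigma P = 1%E.
Let Pclosed := @product_states_closed R N d.
Let Ple1 := @product_states_le1 R N d.

(** [part] stands for the real or the imaginary part, treated at once. *)
Lemma mean_hmx_entry (X : H) k l (part : {additive R[i] -> R}) :
  (forall a z, part (a%:C * z) = a * part z) ->
  \int[sigma]_(p in P) part (((expR (hip X p))%:C *: hmx p) k l) =
  \sum_a zeta P sigma (hip (hbasis a)) X * part (hmx (hbasis a : H) k l).
Proof.
move=> partZ; rewrite -[LHS]/(mean P sigma _).
have cz a : continuous (fun p : H => expR (hip X p) * hip (hbasis a) p).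
  by apply: zeta_integrand_continuous; exact: hip_continuous.
transitivity (mean P sigma (fun p => \sum_a part (hmx (hbasis a : H) k l) *
    (expR (hip X p) * hip (hbasis a) p))).
  apply: eq_mean => p _; rewrite mxE partZ hmx_decomp raddf_sum mulr_sumr.
  by apply: eq_bigr => a _; rewrite partZ (hipC p); ring.
rewrite (mean_sum Pclosed Ple1 sigma_supp) => [|a].
  apply: eq_bigr => a _; rewrite (meanZ Pclosed Ple1 sigma_supp) //.
  exact: mulrC.
by apply: cont_mul; [exact: (@cont_cst R H R^o)|exact: cz].
Qed.

Lemma hmx_chifun (X : H) : hmx (chifun P sigma X) =
  ((Z sigma X)^-1)%:C *: mx_integral sigma (fun p => (expR (hip X p))%:C *: hmx p).
Proof.
apply/matrixP => k l; rewrite hmx_decomp [RHS]mxE [X in _ * X]mxE.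
rewrite (mean_hmx_entry _ _ _ (part := @complex.Re R)); last first.
  by move=> a [b c] /=; ring.
rewrite (mean_hmx_entry _ _ _ (part := @complex.Im R)); last first.
  by move=> a [b c] /=; ring.
rewrite (_ : _ +i* _ = \sum_a (zeta P sigma (hip (hbasis a)) X)%:C * hmx (hbasis a : H) k l).
  rewrite mulr_sumr; apply: eq_bigr => a _.
  rewrite (hip_chifun Pclosed Ple1 sigma_supp) mulrA; congr (_ * _).
  by rewrite rmorphM.
apply/eqP; rewrite eq_complex !raddf_sum /=; apply/andP; split; apply/eqP;
  apply: eq_bigr => a _; case: (hmx (hbasis a : H) k l) => b c /=; ring.
Qed.

End MatrixIntegral.

Theorem theorem13 (R : realType) (N : nat) (d : 'I_N -> nat)
    (hd : forall I, (0 < d I)%N)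
    (sigma : probability (borel_herm R (tensor_dim d)) R)
    (sigma_supp : sigma (product_states R d) = 1%E)
    (sigma_inv : locally_invariant sigma) :
  (forall X : herm R (tensor_dim d),
    differentiable (W sigma) X /\
    hmx (chi sigma X) =
      ((Z sigma X)^-1)%:C *:
        mx_integral sigma (fun P => (expR (hip X P))%:C *: hmx P)) /\
  diffeomorphism
    (traceless R (tensor_dim d)) (traceless R (tensor_dim d))
    (traceless R (tensor_dim d)) (separable_interior R d)
    (chi sigma).
Proof.
have Pclosed := @product_states_closed R N d.
have Ple1 := @product_states_le1 R N d.
have Ptrace := @product_states_trace R N d.
have Psep := @product_states_separating R N d.
have Pfull := product_states_full_support sigma_supp sigma_inv.
have dW X : is_diff X (W sigma) (hip (chifun (product_states R d) sigma X)).
  exact: (Wfun_is_diff Pclosed Ple1 sigma_supp X).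
have chiE : chi sigma = chifun (product_states R d) sigma.
  by apply/funext => X; exact: (gradient_eq (dW X)).
rewrite chiE separable_interiorE.
split=> [X|]; first by split; [case: (dW X)|exact: hmx_chifun].
set K := product_states R d in Pclosed Ple1 Ptrace Psep Pfull *.
(* [xget] selects a traceless preimage and takes the default value 0 where none exists; [chi_onto]
   provides one on the interior. *)
pose g (y : herm R (tensor_dim d)) := xget 0 [set X | hip hone X = 0 /\ chifun K sigma X = y].
have gP y : in_rel_interior K y -> hip hone (g y) = 0 /\ chifun K sigma (g y) = y.
  move=> Dy; rewrite /g; case: xgetP => [X _ //|/= none].
  have [X tX cX] := chi_onto Pclosed Ple1 sigma_supp Ptrace Pfull Dy.
  by case: (none X).
exists g; split.
- move=> X /tracelessP tX.
  have DX : in_rel_interior K (chifun K sigma X) by exact: chi_in_rel_interior.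
  split=> //; have [tg cg] := gP _ DX.
  apply: (chi_inj Pclosed Ple1 sigma_supp Ptrace Pfull Psep) cg.
  by rewrite hipBr tg tX subrr.
- by move=> y Dy; have [tg cg] := gP _ Dy; split=> //; apply/tracelessP.
- by move=> k; exact: chi_smooth.
- move=> k; exact: (inverse_smooth Pclosed Ple1 sigma_supp Ptrace Pfull Psep gP).
Qed.
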